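(* Let $\mathbb{F}$ be a finite field of characteristic $\neq 2$ with $\mathbf{q}$ elements. The Hecke algebra $\mathscr{H}=\mathscr{H}(K,B_K)$ acts by convolution on the space of $K$-orbits $\mathbb{C}\,\mathfrak{X}/K\simeq \mathrm{Fun}^{B_K}(\mathrm{Gr}_r(\mathbb{F}^n))$, and the action is given explicitly on the basis $\{\xi_\tau\}_{\tau\in\overline{\mathfrak{T}}}$ as follows: for every $\tau\in\overline{\mathfrak{T}}$ and every simple reflection $s_i\in W_K$ with corresponding generator $T_i$ of $\mathscr{H}$, $$T_i\ast\xi_\tau=\begin{cases}\mathbf{q}\,\xi_\tau & \text{in Case (I) } (s_i\tau=\tau),\\ (\mathbf{q}-1)\,\xi_\tau+\mathbf{q}\,\xi_{s_i\tau} & \text{in Case (II) } (s_i\tau\neq\tau),\\ \xi_{s_i\tau} & \text{in Case (III) } (s_i\tau\neq\tau).\end{cases}$$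
   Context: Groups and varieties. Let $p,q\ge 1$, $n=p+q$, $1\le r\le n-1$. Over the finite field $\mathbb{F}$ put $G=\mathrm{GL}_n(\mathbb{F})$, $K=\mathrm{GL}_p(\mathbb{F})\times\mathrm{GL}_q(\mathbb{F})$ (block diagonal in $G$), $B_K=B_p(\mathbb{F})\times B_q(\mathbb{F})$ (pairs of invertible upper triangular matrices), $P$ the group of block upper triangular matrices in $G$ with diagonal blocks of sizes $r,n-r$, so $X=G/P=\mathrm{Gr}_r(\mathbb{F}^n)$. Let $\mathfrak{X}=K/B_K\times G/P$ with diagonal $K$-action; $K$-orbits on $\mathfrak{X}$ are identified with $B_K$-orbits on $X$, and $\mathbb{C}\,\mathfrak{X}/K$ with the space $\mathrm{Fun}^{B_K}(X)$ of $B_K$-invariant functions $X\to\mathbb{C}$. $W_K=\mathfrak{S}_p\times\mathfrak{S}_q$, realized as permutation matrices in $K$. Parametrization of orbits. A partial permutation matrix is a $0/1$ matrix with at most one $1$ in each row and each column. Let $\mathfrak{T}$ be the set of $(p+q)\times r$ matrices $\tau=\binom{\tau_1}{\tau_2}$ of rank $r$ with $\tau_1$ ($p\times r$) and $\tau_2$ ($q\times r$) partial permutation matrices, and $\overline{\mathfrak{T}}=\mathfrak{T}/\mathfrak{S}_r$ (permutation of columns). Write $[\tau]\in X$ for the column span of $\tau$. The map $\tau\mapsto B_K\cdot[\tau]$ is a bijection from $\overline{\mathfrak{T}}$ to the set of $B_K$-orbits on $X$. $\xi_\tau$ denotes the characteristic function of $B_K\cdot[\tau]$. $W_K$ acts on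 $\overline{\mathfrak{T}}$ by left multiplication (permuting rows). Graph of $\tau$. It has vertices $1^+,\dots,p^+$ (corresponding to the rows of $\tau_1$) and $1^-,\dots,q^-$ (rows of $\tau_2$); there is an edge $(i^+,j^-)$ if some column of $\tau$ has $1$'s in rows $i^+$ and $j^-$; a vertex is marked if some column has its only $1$ in that row. A vertex has degree $2$ if it is marked, $1$ if it is the endpoint of an edge, $0$ otherwise. Two edges $(i^+,j^-)$ and $(k^+,\ell^-)$ cross if $i<k$ and $j>\ell$ (or vice versa). Cases. Let $s_i$ be a simple reflection of $W_K$, interchanging two consecutive vertices $v,v'$ of the same sign, $v$ before $v'$ (i.e. $v=j^{\pm}$, $v'=(j+1)^{\pm}$). Case (I): $v,v'$ are both of degree $0$ or both of degree $2$ (equivalently $s_i\tau=\tau$ in $\overline{\mathfrak{T}}$). Case (II): $\deg v<\deg v'$, or $v,v'$ are endpoints of two edges which cross. Case (III): $\deg v>\deg v'$, or $v,v'$ are endpoints of two edges which do not cross. Hecke algebra. $\mathscr{H}(K,B_K)$ is the algebra of $B_K$-bi-invariant functions $K\to\mathbb{C}$ with product $(a\ast b)(x)=\frac{1}{\#K}\sum_{k\in K}a(k)b(k^{-1}x)$; it acts on $\mathrm{Fun}^{B_K}(X)$ by $(f\ast\xi)(x)=\frac{1}{\#K}\sum_{k\in K}f(k)\xi(k^{-1}x)$. $T_i=\frac{\#K}{\#B_K}\mathbf{1}_{B_Ks_iB_K}$, where $\mathbf{1}_{B_Ks_iB_K}$ is the characteristic function of the double coset. *)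

(* Defs.v *)
From HB Require Import structures.
From mathcomp Require Import all_boot all_order all_algebra all_fingroup.
From mathcomp Require Import reals complex.

Set Implicit Arguments.
Unset Strict Implicit.
Unset Printing Implicit Defensive.

Import GRing.Theory.
Local Open Scope ring_scope.

(* Functions on a set are plain Rocq functions, compared pointwise (=1).      *)
Section Hecke.

Variables (C : fieldType) (K : finGroupType) (B : {set K}).

Definition in_hecke (a : K -> C) : Prop :=
  forall b b' k : K, b \in B -> b' \in B -> a (b * k * b')%g = a k.

Definition hecke_conv (a b : K -> C) : K -> C :=
  fun x => #|K|%:R^-1 * \sum_(k : K) a k * b (k^-1 * x)%g.

Definition hecke_one : K -> C :=
  fun x => #|K|%:R / #|B|%:R * (x \in B)%:R.

Definition hecke_T (s : K) : K -> C :=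
  fun x => #|K|%:R / #|B|%:R * (x \in (B :* s * B)%g)%:R.

Record hecke_is_algebra : Prop := HeckeIsAlgebra {
  heckeP1 : in_hecke hecke_one;
  heckePM a b : in_hecke a -> in_hecke b -> in_hecke (hecke_conv a b);
  heckePL (c : C) a b :
    in_hecke a -> in_hecke b -> in_hecke (fun k => c * a k + b k);
  hecke1M a : in_hecke a -> hecke_conv hecke_one a =1 a;
  heckeM1 a : in_hecke a -> hecke_conv a hecke_one =1 a;
  heckeMA a b c : in_hecke a -> in_hecke b -> in_hecke c ->
    hecke_conv a (hecke_conv b c) =1 hecke_conv (hecke_conv a b) c;
  heckeMDl (c : C) a b d : in_hecke a -> in_hecke b -> in_hecke d ->
    hecke_conv (fun k => c * a k + b k) d
      =1 (fun x => c * hecke_conv a d x + hecke_conv b d x);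
  heckeMDr (c : C) a b d : in_hecke a -> in_hecke b -> in_hecke d ->
    hecke_conv d (fun k => c * a k + b k)
      =1 (fun x => c * hecke_conv d a x + hecke_conv d b x)
}.

Variables (X : Type) (act : K -> X -> X).

Definition invariant_fun (A : {set K}) (xi : X -> C) : Prop :=
  forall (k : K) (x : X), k \in A -> xi (act k x) = xi x.

Definition hecke_act (f : K -> C) (xi : X -> C) : X -> C :=
  fun x => #|K|%:R^-1 * \sum_(k : K) f k * xi (act k^-1%g x).

Record hecke_acts : Prop := HeckeActs {
  hecke_act_inv a xi :
    in_hecke a -> invariant_fun B xi -> invariant_fun B (hecke_act a xi);
  hecke_act1 xi : invariant_fun B xi -> hecke_act hecke_one xi =1 xi;
  hecke_actM a b xi : in_hecke a -> in_hecke b -> invariant_fun B xi ->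
    hecke_act (hecke_conv a b) xi =1 hecke_act a (hecke_act b xi);
  hecke_actDl (c : C) a b xi :
    in_hecke a -> in_hecke b -> invariant_fun B xi ->
    hecke_act (fun k => c * a k + b k) xi
      =1 (fun x => c * hecke_act a xi x + hecke_act b xi x);
  hecke_actDr (c : C) a xi eta :
    in_hecke a -> invariant_fun B xi -> invariant_fun B eta ->
    hecke_act a (fun x => c * xi x + eta x)
      =1 (fun x => c * hecke_act a xi x + hecke_act a eta x)
}.

End Hecke.

Section KBX.

Variables (F : finFieldType) (p q r : nat).

(* Since p, q >= 1, the block sizes are p.+1 and q.+1: {'GL_m[F]} consists    *)
(* of matrices of size m.-1.+1, hence of size m only for m a successor.       *)
Definition grpK := ({'GL_p.+1[F]} * {'GL_q.+1[F]})%type.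

Definition blockK (k : grpK) : 'M[F]_(p.+1 + q.+1) :=
  block_mx (GLval k.1) 0 0 (GLval k.2).

Definition borelK : {set grpK} :=
  [set k : grpK | is_trig_mx (GLval k.1)^T && is_trig_mx (GLval k.2)^T].

Lemma blockK_unit (k : grpK) : blockK k \in unitmx.
Proof.
rewrite unitmxE det_ublock unitrM -!unitmxE.
by apply/andP; split; [exact: (valP k.1) | exact: (valP k.2)].
Qed.

Definition Gr := {V : {vspace 'cV[F]_(p.+1 + q.+1)} | \dim V == r}.

Lemma Gr_act_subproof (k : grpK) (V : Gr) :
  \dim (linfun (mulmx (blockK k)) @: val V)%VS == r.
Proof.
rewrite limg_dim_eq ?(eqP (valP V)) //.
suff /eqP -> : lker (linfun (mulmx (blockK k)) :
  'Hom('cV[F]_(p.+1 + q.+1), 'cV[F]_(p.+1 + q.+1))) == 0%VS by rewrite capv0.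
apply/lker0P => u v; rewrite !lfunE /= => /(congr1 (mulmx (invmx (blockK k)))).
by rewrite !mulKmx ?blockK_unit.
Qed.

Definition Gr_act (k : grpK) (V : Gr) : Gr :=
  Sub (linfun (mulmx (blockK k)) @: val V)%VS (Gr_act_subproof k V).

(* K / B_K, as the set of left cosets k B_K.                                  *)
Definition flagK := {c : {set grpK} | c \in lcosets borelK [set: grpK]}.

Lemma flag_base_subproof : borelK \in lcosets borelK [set: grpK].
Proof. by apply/lcosetsP; exists 1%g; rewrite ?inE // mul1g. Qed.

Definition flag_base : flagK := Sub borelK flag_base_subproof.

Lemma flag_act_subproof (k : grpK) (c : flagK) :
  (k *: val c)%g \in lcosets borelK [set: grpK].
Proof.
have /lcosetsP [x _ ->] := valP c.
by apply/lcosetsP; exists (k * x)%g; rewrite ?inE // lcosetM.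
Qed.

Definition flag_act (k : grpK) (c : flagK) : flagK :=
  Sub (k *: val c)%g (flag_act_subproof k c).

Definition doubleflag := (flagK * Gr)%type.

Definition doubleflag_act (k : grpK) (z : doubleflag) : doubleflag :=
  (flag_act k z.1, Gr_act k z.2).

End KBX.

Arguments Gr_act {F p q r}.
Arguments doubleflag_act {F p q r}.

Section OrbitParam.

Variables (F : finFieldType).

Definition is_partial_perm_mx m n (A : 'M[F]_(m, n)) : bool :=
  [&& [forall i, forall j, (A i j == 0) || (A i j == 1)],
      [forall i, (#|[set j | A i j == 1%R]| <= 1)%N]
    & [forall j, (#|[set i | A i j == 1%R]| <= 1)%N]].

Variables (p q r : nat).

Definition is_param (t : 'M[F]_(p.+1 + q.+1, r)) : bool :=
  [&& is_partial_perm_mx (usubmx t), is_partial_perm_mx (dsubmx t)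
    & \rank t == r].

Definition param := {t : 'M[F]_(p.+1 + q.+1, r) | is_param t}.

Definition col_equiv (t u : param) : bool :=
  [exists s : 'S_r, val u == col_perm s (val t)].

Lemma col_equiv_refl : reflexive col_equiv.
Proof. by move=> t; apply/existsP; exists 1%g; rewrite col_perm1. Qed.

Lemma col_equiv_sym : symmetric col_equiv.
Proof.
suff sub t u : col_equiv t u -> col_equiv u t.
  by move=> t u; apply/idP/idP; apply: sub.
case/existsP=> s /eqP def_u; apply/existsP; exists s^-1%g.
by rewrite def_u -col_permM mulVg col_perm1.
Qed.

Lemma col_equiv_trans : transitive col_equiv.
Proof.
move=> u t v /existsP [s /eqP def_u] /existsP [s' /eqP def_v].
by apply/existsP; exists (s' * s)%g; rewrite def_v def_u -col_permM.
Qed.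

Canonical col_equiv_equiv :=
  EquivRel col_equiv col_equiv_refl col_equiv_sym col_equiv_trans.

Definition paramQ := {eq_quot col_equiv}%qT.


Definition param_class (t : param) : paramQ := (\pi_paramQ t)%qT.

(* W_K = S_p x S_q as permutation matrices in K.                              *)
Definition weylK (w : 'S_p.+1 * 'S_q.+1) : grpK F p q :=
  (Sub (perm_mx w.1) (unitmx_perm F w.1),
   Sub (perm_mx w.2) (unitmx_perm F w.2)).

Lemma perm_partial_perm_mx m n (s : 'S_m) (A : 'M[F]_(m, n)) :
  is_partial_perm_mx A -> is_partial_perm_mx (perm_mx s *m A).
Proof.
rewrite -row_permE => /and3P [/forallP A01 /forallP Ar /forallP Ac].
apply/and3P; split; apply/forallP => i.
- by apply/forallP => j; rewrite mxE; exact: (forallP (A01 (s i))).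
- by apply: leq_trans (Ar (s i)); apply/subset_leq_card/subsetP => j;
    rewrite !inE mxE.
- apply: leq_trans (Ac i).
  rewrite -(card_preimset [set k | A k i == 1] (@perm_inj _ s)).
  by apply/subset_leq_card/subsetP => j; rewrite !inE mxE.
Qed.

Lemma param_act_subproof (w : 'S_p.+1 * 'S_q.+1) (t : param) :
  is_param (blockK (weylK w) *m val t).
Proof.
have /and3P [t1 t2 t3] := valP t; rewrite /is_param.
rewrite eqmxMfull ?row_full_unit ?blockK_unit // t3 andbT.
rewrite -[X in blockK _ *m X]vsubmxK mul_block_col !mul0mx addr0 add0r.
by rewrite col_mxKu col_mxKd !perm_partial_perm_mx.
Qed.

Definition param_act (w : 'S_p.+1 * 'S_q.+1) (t : param) : param :=
  Sub (blockK (weylK w) *m val t) (param_act_subproof w t).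

Definition colspan n (t : 'M[F]_(n, r)) : {vspace 'cV[F]_n} :=
  <<[seq col j t | j : 'I_r]>>%VS.

Lemma param_span_subproof (t : param) : \dim (colspan (val t)) == r.
Proof.
have /and3P [_ _ rank_t] := valP t.
have freeX : free [tuple of [seq col j (val t) | j : 'I_r]].
  apply/freeP => k sum0.
  pose v : 'rV[F]_r := \row_j k (enum_rank j).
  suff v0 : v = 0.
    by move=> i; move/rowP/(_ (enum_val i)): v0; rewrite !mxE enum_valK.
  have free_t : row_free (val t)^T by rewrite /row_free mxrank_tr.
  apply: (row_free_inj free_t); rewrite /= mul0mx -[LHS]trmxK trmx_mul trmxK -[RHS]trmxK trmx0; congr (_^T).
  rewrite -{}[RHS]sum0; apply/colP => i; rewrite summxE !mxE.
  rewrite (reindex (fun j : 'I_#|'I_r| => enum_val j)) /=; last first.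
    by exists enum_rank => j _; rewrite ?enum_valK ?enum_rankK.
  apply: eq_bigr => j _.
  rewrite (nth_map (enum_val j)) -?cardE // !mxE -enum_val_nth enum_valK.
  by rewrite mulrC.
by apply/eqP; rewrite (eqnP freeX) size_tuple card_ord.
Qed.

Definition param_span (t : param) : Gr F p q r :=
  Sub (colspan (val t)) (param_span_subproof t).

Definition in_param_orbit (t : param) (V : Gr F p q r) : bool :=
  [exists b in borelK F p q, V == Gr_act b (param_span t)].

(* The B_K-orbit of [tau] only depends on tau up to column permutation, hence *)
(* may be computed on any representative.                                     *)
Definition xi (C : fieldType) (t : paramQ) : Gr F p q r -> C :=
  fun V => (in_param_orbit (generic_quotient.repr t) V)%:R.

End OrbitParam.

HB.instance Definition _ F p q r := [Finite of paramQ F p q r by <:%/].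

Section Graph.

Variables (F : finFieldType) (p q r : nat) (t : 'M[F]_(p + q, r)).

(* inl i is the vertex i^+, inr j is the vertex j^-, and unsplit maps a       *)
(* vertex to the corresponding row.                                           *)
Definition vertex := ('I_p + 'I_q)%type.

Definition is_edge (e : 'I_p * 'I_q) : bool :=
  [exists c, (t (lshift q e.1) c == 1) && (t (rshift p e.2) c == 1)].

Definition is_marked (v : vertex) : bool :=
  [exists c, [forall i, (t i c == 1) == (i == unsplit v)]].

Definition endpoint (v : vertex) (e : 'I_p * 'I_q) : bool :=
  match v with inl i => e.1 == i | inr j => e.2 == j end.

Definition deg (v : vertex) : nat :=
  if is_marked v then 2%N
  else if [exists e, is_edge e && endpoint v e] then 1%N else 0%N.

Definition cross (e f : 'I_p * 'I_q) : bool :=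
  ((e.1 < f.1) && (f.2 < e.2) || (f.1 < e.1) && (e.2 < f.2))%N.

Definition consecutive (v v' : vertex) : bool :=
  match v, v' with
  | inl i, inl i' => i' == i.+1 :> nat
  | inr j, inr j' => j' == j.+1 :> nat
  | _, _ => false
  end.

Definition caseI (v v' : vertex) : bool :=
  ((deg v == 0) && (deg v' == 0) || (deg v == 2) && (deg v' == 2))%N.

Definition caseII (v v' : vertex) : bool :=
  (deg v < deg v')%N ||
  [exists e, exists f, [&& is_edge e, is_edge f, endpoint v e, endpoint v' f
                         & cross e f]].

Definition caseIII (v v' : vertex) : bool :=
  (deg v' < deg v)%N ||
  [exists e, exists f, [&& is_edge e, is_edge f, endpoint v e, endpoint v' f
                         & ~~ cross e f]].

End Graph.

(* Only meaningful for vertices of the same sign; 1 otherwise.              *)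
Definition vertex_swap p q (v v' : vertex p q) : 'S_p * 'S_q :=
  match v, v' with
  | inl i, inl i' => (tperm i i', 1%g)
  | inr j, inr j' => (1%g, tperm j j')
  | _, _ => (1%g, 1%g)
  end.

Definition simple_refl F p q (v v' : vertex p.+1 q.+1) : grpK F p q :=
  weylK F (vertex_swap v v').

(* Functions on the set of K-orbits of the double flag variety K/B_K x G/P    *)
(* are K-invariant functions on it; x |-> (B_K, x) identifies B_K-orbits on   *)
(* G/P with these K-orbits.                                                   *)
Definition base_restr (C : fieldType) F p q r
    (Phi : doubleflag F p q r -> C) : Gr F p q r -> C :=
  fun V => Phi (flag_base F p q, V).

(* Main.v *)
Require Import Defs.
From mathcomp Require Import all_boot all_order all_algebra all_fingroup.
From mathcomp Require Import reals complex.

(** A point of the Grassmannian is the column span of a matrix of rank r, up to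
    column operations, so the orbits of B_K on it are the orbits of
    B_K x GL_r on these matrices. Gaussian elimination, first in the upper
    block of rows and then in the lower one with the column operations that the
    upper block can still absorb, brings each matrix to some tau
    (elimination, normal_form). Conversely tau is determined by its orbit: in
    an equation t = k u h a nonzero term of det h matches the columns of u with
    those of t, moving pivots downwards only, and the converse equation moves
    them back (same_orbit_pivot_le, same_orbit_col_equiv). Hence the functions
    xi_tau form a basis of the invariant functions (xi_basis), and identities
    between invariant functions can be checked at the points [sigma]
    (invariant_ext).

    For a simple reflection s exchanging rows i0 and i1 = i0 + 1, the double
    coset B s B is the disjoint union of the cosets u(-a) s B, where u(a) adds a
    times row i1 to row i0 and a runs over F. Therefore
    (T xi)([sigma]) is the sum over a of xi (s u(a) [sigma]), and everything
    depends on which orbit contains s u(a) [sigma].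

    Give each vertex a label: 0 if it is marked, the position of the other end
    if it lies on an edge, and infinity if it has degree 0. Cases (I), (II) and
    (III) mean that the label of v is equal to, larger than or smaller than that
    of v'. If it is at most that of v', the operation u(a) on sigma is a column
    operation followed by a row operation of B_K commuting with s
    (root_absorbed), so s u(a) [sigma] lies in the orbit of s sigma for every a.
    If it is at least that of v', the same applies to s sigma, and the relation
    s u(a) in B s u(1/a) s for a != 0 (swap_root_swap) shows that
    s u(a) [sigma] lies in the orbit of sigma, while for a = 0 it is
    [s sigma]. When the labels are equal both statements hold, which forces
    s sigma = sigma. Counting the values of a gives q in the first situation,
    and 1 and q - 1 in the second (hecke_T_span_le, hecke_T_span_ge); comparing
    with the label of tau gives the three formulas. *)

Set Implicit Arguments.
Unset Strict Implicit.
Unset Printing Implicit Defensive.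

Import GRing.Theory.
Local Open Scope ring_scope.

(** * Convolution and functions on cosets *)

Section HeckeGenerality.

Variables (C : numFieldType) (K : finGroupType) (B : {group K}).

Lemma in_hecke_T (s : K) : in_hecke B (hecke_T C B s).
Proof.
have stable b b' k : b \in B -> b' \in B ->
    (k \in B :* s * B -> b * k * b' \in B :* s * B)%g.
  move=> bB b'B /mulsgP [_ y /rcosetP [x xB ->] yB ->].
  apply/mulsgP; exists (b * x * s)%g (y * b')%g; rewrite ?groupM ?mulgA //.
  by apply/rcosetP; exists (b * x)%g; rewrite ?groupM.
move=> b b' k bB b'B; rewrite /hecke_T; congr (_ * _%:R).
congr nat_of_bool; apply/idP/idP => [|/(stable _ _ _ bB b'B) //].
move=> /(stable b^-1 b'^-1 _)%g; rewrite !groupV => /(_ bB b'B).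
by rewrite !mulgA mulVg mul1g mulgK.
Qed.

(** The normalisation of the unit: #K / #B times the indicator of a translate
    of B has mean 1 over K. Every evaluation of a convolution against an
    indicator function below reduces to this. *)
Lemma mean_over_borel (s : K -> K) : injective s -> forall y : C,
  #|K|%:R^-1 * \sum_k #|K|%:R / #|B|%:R * (s k \in B)%:R * y = y.
Proof.
move=> s_inj y; rewrite (eq_bigr (fun k =>
  #|K|%:R / #|B|%:R * y * (s k \in B)%:R)).
  rewrite -mulr_sumr -natr_sum (_ : (\sum_k (s k \in B))%N = #|B|); last first.
    by rewrite -sum1_card [RHS](reindex_inj s_inj) [RHS]big_mkcond.
  have nzB : #|B|%:R != 0 :> C by rewrite Num.Theory.pnatr_eq0 -lt0n cardG_gt0.
  have nzK : #|K|%:R != 0 :> C.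
    by rewrite Num.Theory.pnatr_eq0 -lt0n -cardsT; apply/card_gt0P; exists 1%g.
  by rewrite [_ * #|B|%:R]mulrAC divfK // mulKf.
by move=> k _; rewrite mulrAC.
Qed.

Section Action.

Variables (X : Type) (act : K -> X -> X).
Hypothesis actM : forall k l x, act (k * l)%g x = act k (act l x).

Lemma hecke_act_invariant (a : K -> C) (f : X -> C) :
  in_hecke B a -> invariant_fun act B (hecke_act act a f).
Proof.
move=> aB b x bB; rewrite /hecke_act; congr (_ * _).
rewrite (reindex_inj (mulgI b)); apply: eq_bigr => k _ /=.
by rewrite -[(b * k)%g]mulg1 aB // mulg1 -actM invMg mulgKV.
Qed.

Lemma hecke_act_one (f : X -> C) :
  invariant_fun act B f -> hecke_act act (hecke_one C B) f =1 f.
Proof.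
move=> fB x; rewrite -[RHS](mean_over_borel (@inj_id K)) /hecke_act /hecke_one.
congr (_ * _); apply: eq_bigr => k _; rewrite -!mulrA; congr (_ * (_ * _)).
by case: (boolP (k \in B)) => kB; rewrite ?mul0r // fB ?groupV.
Qed.

Lemma hecke_act_conv (a b : K -> C) (f : X -> C) :
  hecke_act act (hecke_conv a b) f =1 hecke_act act a (hecke_act act b f).
Proof.
move=> x; rewrite /hecke_act /hecke_conv; congr (_ * _).
under eq_bigr => k _ do rewrite -mulrA mulr_suml mulr_sumr.
rewrite exchange_big; apply: eq_bigr => l _ /=.
rewrite mulrCA mulr_sumr mulr_sumr.
rewrite (reindex_inj (mulgI l)); apply: eq_bigr => k _ /=.
by rewrite mulKg invMg actM !mulrA.
Qed.

Lemma hecke_act_linear_l (c : C) (a b : K -> C) (f : X -> C) :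
  hecke_act act (fun k => c * a k + b k) f
    =1 (fun x => c * hecke_act act a f x + hecke_act act b f x).
Proof.
move=> x; rewrite /hecke_act mulrCA -mulrDr [c * _]mulr_sumr -big_split /=.
by congr (_ * _); apply: eq_bigr => k _; rewrite mulrDl mulrA.
Qed.

Lemma hecke_act_linear_r (c : C) (a : K -> C) (f g : X -> C) :
  hecke_act act a (fun x => c * f x + g x)
    =1 (fun x => c * hecke_act act a f x + hecke_act act a g x).
Proof.
move=> x; rewrite /hecke_act mulrCA -mulrDr [c * _]mulr_sumr -big_split /=.
by congr (_ * _); apply: eq_bigr => k _; rewrite mulrDr mulrCA.
Qed.

Lemma hecke_actsP : hecke_acts C B act.
Proof.
split=> *; [exact: hecke_act_invariant | exact: hecke_act_one
  | exact: hecke_act_conv | exact: hecke_act_linear_l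
  | exact: hecke_act_linear_r].
Qed.

End Action.

(** Left convolution is the action attached to K acting on itself by left
    translation, so most of the algebra axioms are instances of the lemmas on
    actions; only right invariance and the right unit are extra. *)
Lemma hecke_algebraP : hecke_is_algebra C B.
Proof.
have mulA (k l x : K) : (k * l * x = k * (l * x))%g by rewrite mulgA.
have inv (a : K -> C) : in_hecke B a -> invariant_fun ( *%g ) B a.
  by move=> aB k x kB; rewrite -[(k * x)%g]mulg1 aB.
have convE a b : @hecke_conv C K a b = hecke_act ( *%g ) a b by [].
split.
- by move=> b b' k bB b'B; rewrite /hecke_one groupMr // groupMl.
- move=> a b aB bB u u' k uB u'B.
  rewrite !convE -mulgA (hecke_act_invariant mulA _ aB) //.
  rewrite /hecke_act; congr (_ * _); apply: eq_bigr => l _; congr (_ * _).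
  by rewrite mulgA -[(l^-1 * k * u')%g]mul1g mulgA bB.
- by move=> c a b aB bB u u' k uB u'B; rewrite aB // bB.
- by move=> a aB; rewrite convE; apply/hecke_act_one/inv.
- move=> a aB x; rewrite /hecke_conv.
  have s_inj : injective (fun k => k^-1 * x)%g by move=> k l /mulIg/invg_inj.
  rewrite -[RHS](mean_over_borel s_inj); congr (_ * _).
  apply: eq_bigr => k _; rewrite /hecke_one mulrC.
  case: (boolP (k^-1 * x \in B)%g) => kxB; last by rewrite mulr0 !mul0r.
  by congr (_ * _); rewrite -[RHS](aB 1%g _ x _ (groupVr kxB)) //
    mul1g invMg invgK mulKVg.
- by move=> a b c _ _ _ x; rewrite !convE -hecke_act_conv.
- by move=> *; exact: hecke_act_linear_l.
- by move=> *; exact: hecke_act_linear_r.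
Qed.

End HeckeGenerality.

(** * Gaussian elimination to partial permutation form *)

Section Elimination.

Variables (F : finFieldType) (m n : nat).

Lemma partial_perm_mxP (A : 'M[F]_(m, n)) :
  reflect [/\ forall i j, A i j != 0 -> A i j = 1,
              forall i j k, A i j != 0 -> A i k != 0 -> j = k
            & forall i k j, A i j != 0 -> A k j != 0 -> i = k]
          (is_partial_perm_mx A).
Proof.
apply: (iffP and3P) => [[/forallP A01 /forallP Arow /forallP Acol]|].
  have A1 i j : A i j != 0 -> A i j = 1.
    by move=> nz; case/orP: (forallP (A01 i) j) => /eqP // A0;
      rewrite A0 eqxx in nz.
  split=> // [i j k /A1 Aij /A1 Aik | i k j /A1 Aij /A1 Akj].
    by apply: (card_le1_eqP (Arow i)); rewrite inE ?Aij ?Aik.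
  by apply: (card_le1_eqP (Acol j)); rewrite inE ?Aij ?Akj.
have nz1 i j : A i j == 1 -> A i j != 0 by move/eqP->; rewrite oner_eq0.
case=> A1 Arow Acol; split; apply/forallP => i.
- by apply/forallP => j; case: eqP => //= /eqP /A1 ->.
- apply/card_le1_eqP => j k; rewrite !inE => /nz1 Aij /nz1 Aik.
  exact: Arow Aik Aij.
- apply/card_le1_eqP => j k; rewrite !inE => /nz1 Aij /nz1 Aik.
  exact: Acol Aik Aij.
Qed.

(** The loop invariant of the elimination, for the rows already treated: such
    a row is zero or is a pivot row whose pivot is alone in its row and in its
    column. *)
Definition reduced_row (A : 'M[F]_(m, n)) (i : 'I_m) : Prop :=
  (forall j, A i j = 0) \/
  exists j, (forall k, A i k = (k == j)%:R) /\ (forall k, k != i -> A k j = 0).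

Lemma partial_perm_of_reduced (A : 'M[F]_(m, n)) :
  (forall i, reduced_row A i) -> is_partial_perm_mx A.
Proof.
move=> red; apply/partial_perm_mxP.
have piv i j : A i j != 0 ->
    (forall k, A i k = (k == j)%:R) /\ (forall k, k != i -> A k j = 0).
  case: (red i) => [-> | [c [Ai Ac]]]; first by rewrite eqxx.
  by rewrite Ai; case: (eqVneq j c) => [-> | _]; rewrite ?eqxx.
split=> [i j /piv [-> _] | i j k /piv [Ai _] | i k j /piv [_ Ac]].
- by rewrite eqxx.
- by rewrite Ai; case: (eqVneq k j) => // _; rewrite eqxx.
- by case: (eqVneq i k) => // ik; rewrite Ac ?eqxx // eq_sym.
Qed.

(** A Bruhat decomposition, packaged as an induction principle: any matrix is
    reduced to a partial permutation matrix by row operations that modify only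
    the rows above and including the row used, and by column operations that
    modify only columns of larger or equal key. The rows are treated from the
    bottom up; in a nonzero row the pivot is chosen in a column of least key, so
    that it can clear the rest of its row. The columns of earlier pivots vanish
    in the current row, hence the rows below are left unchanged. With a
    constant key all column operations are allowed. *)
Lemma elimination (key : 'I_n -> nat) (P : 'M[F]_(m, n) -> Prop) :
  (forall (i : 'I_m) (u : 'cV_m) (A : 'M_(m, n)), (forall k, u k 0 != 0 ->
    (k <= i)%N) ->
     1 + u i 0 != 0 -> P (A + u *m row i A) -> P A) ->
  (forall (j : 'I_n) (w : 'rV_n) (A : 'M_(m, n)), w 0 j = 0 ->
     (forall k, w 0 k != 0 -> (key j <= key k)%N) ->
     P (A + col j A *m w) -> P A) ->
  (forall A, is_partial_perm_mx A -> P A) ->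
  forall A, P A.
Proof.
move=> Prow Pcol Pperm.
suff main d (A : 'M[F]_(m, n)) :
    (forall i : 'I_m, (d <= i)%N -> reduced_row A i) -> P A.
  by move=> A; apply: (main m) => i; rewrite leqNgt ltn_ord.
elim: d A => [|d IHd] A red.
  by apply/Pperm/partial_perm_of_reduced => i; apply: red.
have [d_lt_m | m_le_d] := ltnP d m; last first.
  by apply: IHd => i; rewrite leqNgt (leq_trans (ltn_ord i)).
pose i := Ordinal d_lt_m.
have [/existsP [j0 Aij0] | /existsPn Ai0] := boolP [exists j, A i j != 0];
  last first.
  apply: IHd => k; rewrite leq_eqVlt => /orP [/eqP dk | /red //].
  have -> : k = i by apply: val_inj.
  by left=> j; apply/eqP; rewrite -[_ == _]negbK.
pose j := [arg min_(j < j0 | A i j != 0) key j]; pose a := A i j.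
have [a_neq0 j_min] : a != 0 /\ forall k, A i k != 0 -> (key j <= key k)%N.
  by rewrite /a /j; case: arg_minnP => // k Aik min_k.
have below (k : 'I_m) : (i < k)%N -> A k j = 0.
  move=> ik; case: (red k ik) => [-> // | [c [Ak Ac]]].
  rewrite Ak; case: (eqVneq j c) => // jc; case/eqP: a_neq0.
  by rewrite /a jc Ac // -val_eqE /= neq_ltn ik.
(* w clears the rest of row i; u normalises the pivot and clears column j *)
pose w : 'rV_n := \row_k (if k == j then 0 else - (A i k / a)).
pose u : 'cV_m := \col_k (if k == i then a^-1 - 1 else - (A k j / a)).
apply: (Pcol j w); first by rewrite mxE eqxx.
  move=> k; rewrite mxE; case: (k =P j) => [_|_]; first by rewrite eqxx.
  by rewrite oppr_eq0 mulf_eq0 => /norP [/j_min].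
apply: (Prow i u).
- move=> k; rewrite mxE; case: (eqVneq k i) => [-> // | _].
  by rewrite leqNgt; apply: contra => /below ->; rewrite mul0r oppr0.
- by rewrite mxE eqxx addrC subrK invr_neq0.
have row_i : row i (A + col j A *m w) = a *: delta_mx 0 j.
  apply/rowP => l; rewrite !mxE big_ord1 !mxE -/a.
  case: (eqVneq l j) => [-> | _]; first by rewrite mulr0 addr0 mulr1.
  by rewrite mulrN [a * (_ / _)]mulrC divfK // subrr mulr0.
rewrite {}row_i; set A2 := (X in P X).
have A2E k l : A2 k l = if l == j then (k == i)%:R else A k l - A k j * A i l
  / a.
  rewrite /A2 !mxE !big_ord1 !mxE; case: (eqVneq l j) => [-> | lj].
    rewrite mulr0 addr0 mulr1; case: (eqVneq k i) => [-> | _].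
      by rewrite mulrBl mulVf // mul1r -/a addrC subrK.
    by rewrite mulNr divfK // subrr.
  by rewrite !mulr0 addr0 mulrN mulrA.
apply: IHd => k; rewrite leq_eqVlt => /orP [/eqP dk | dk].
  have -> : k = i by apply: val_inj.
  right; exists j; split=> [l | l /negPf li]; rewrite A2E ?eqxx ?li //.
  by case: (eqVneq l j) => // _; rewrite -/a [a * _]mulrC mulfK // subrr.
have Akj := below k dk.
have ki : k != i by rewrite -val_eqE /= neq_ltn dk orbT.
have A2k l : A2 k l = A k l.
  by rewrite A2E Akj !mul0r subr0 (negPf ki); case: eqP => [->|].
case: (red k dk) => [Ak | [c [Ak Ac]]]; first by left=> l; rewrite A2k.
right; exists c; split=> [l | l lk]; first by rewrite A2k.
have cj : c != j.
  by apply/eqP => cj; move: (Ak c); rewrite eqxx cj Akj => /esym /eqP;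
    rewrite oner_eq0.
by rewrite A2E (negPf cj) Ac // Ac 1?eq_sym // mulr0 mul0r subr0.
Qed.

End Elimination.

(** * The Borel subgroup inside the block diagonal matrices *)

Section Borel.

Variables (F : finFieldType) (p q : nat).
Local Notation n := (p.+1 + q.+1)%N.
Local Notation K := (grpK F p q).
Local Notation B := (borelK F p q).

Definition upper_block (i : 'I_n) : bool := (i < p.+1)%N.

Lemma upper_block_l i : upper_block (lshift q.+1 i).
Proof. exact: (ltn_ord i). Qed.

Lemma upper_block_r i : upper_block (rshift p.+1 i) = false.
Proof. by rewrite /upper_block /= ltnNge leq_addr. Qed.

Lemma blockKM (k l : K) : blockK (k * l)%g = blockK k *m blockK l.
Proof. by rewrite /blockK mulmx_block !mul0mx !mulmx0 !addr0 !add0r. Qed.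

Lemma blockK1 : blockK (1%g : K) = 1%:M.
Proof. by rewrite /blockK -scalar_mx_block. Qed.

Lemma blockKV (k : K) : blockK k^-1%g *m blockK k = 1%:M.
Proof. by rewrite -blockKM mulVg blockK1. Qed.

Lemma blockK_inj : injective (@blockK F p q).
Proof.
by move=> [k1 k2] [l1 l2] /eq_block_mx [e1 _ _ e2]; congr (_, _); apply:
  val_inj.
Qed.

Lemma borelKP (k : K) :
  reflect (forall i j : 'I_n, blockK k i j != 0 ->
             upper_block i = upper_block j /\ (i <= j)%N) (k \in B).
Proof.
rewrite inE; apply: (iffP andP) => [[/is_trig_mxP tr1 /is_trig_mxP tr2] i j|tr].
  case: (split_ordP i) => i' ->; case: (split_ordP j) => j' ->;
    rewrite ?block_mxEul ?block_mxEur ?block_mxEdl ?block_mxEdr ?mxE ?eqxx //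
      ?upper_block_l ?upper_block_r /= => nz; split=> //.
    by rewrite leqNgt; apply: contraNN nz => /tr1; rewrite mxE => ->.
  by rewrite leq_add2l leqNgt; apply: contraNN nz => /tr2; rewrite mxE => ->.
split; apply/is_trig_mxP => i j ij; rewrite mxE; apply/eqP; apply:
  contraLR ij => nz.
  by have := tr (lshift _ j) (lshift _ i); rewrite block_mxEul -leqNgt =>
    /(_ nz) [].
have := tr (rshift _ j) (rshift _ i); rewrite block_mxEdr => /(_ nz) [_].
by rewrite /= leq_add2l -leqNgt.
Qed.

Lemma borelK_1 : (1%g : K) \in B.
Proof.
apply/borelKP => i j; rewrite blockK1 !mxE.
by case: (eqVneq i j) => [-> | _]; rewrite ?eqxx.
Qed.

Lemma borelK_M (k l : K) : k \in B -> l \in B -> (k * l)%g \in B.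
Proof.
move=> /borelKP kB /borelKP lB; apply/borelKP => i j.
rewrite blockKM mxE => /eqP nz.
have [x /andP [/kB [ix xi] /lB [jx xj]]] :
    exists x, (blockK k i x != 0) && (blockK l x j != 0).
  apply/existsP; apply: contra_notT nz => /existsPn z; apply: big1 => x _.
  by have := z x; rewrite negb_and !negbK => /orP [] /eqP ->;
    rewrite ?mul0r ?mulr0.
by rewrite ix jx (leq_trans xi).
Qed.

Lemma borelK_group_set : group_set B.
Proof. by apply/group_setP; split; [exact: borelK_1 | exact: borelK_M]. Qed.

Canonical borelK_group := Group borelK_group_set.

(** Left translation by k maps B injectively, hence bijectively, to itself, so
    the inverse of k is found in B. *)
Lemma borelK_V (k : K) : k \in B -> (k^-1)%g \in B.
Proof.
move=> kB; pose f (l : K) : K := (k * l)%g.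
have f_inj : injective f.
  move=> x y /(congr1 (@blockK F p q)); rewrite !blockKM.
  move=> /(congr1 (mulmx (invmx (blockK k)))).
  by rewrite !mulKmx ?blockK_unit // => /blockK_inj.
have : 1%g \in [set f l | l in B].
  rewrite (_ : [set f l | l in B] = B) ?borelK_1 //; apply/eqP.
  rewrite eqEcard card_imset // leqnn andbT.
  by apply/subsetP => _ /imsetP [l lB ->]; apply: borelK_M.
move=> /imsetP [l lB /(congr1 (@blockK F p q))]; rewrite blockK1 blockKM => kl.
suff -> : (k^-1)%g = l by [].
by apply: blockK_inj; rewrite -[LHS]mulmx1 kl mulmxA blockKV mul1mx.
Qed.

(** Produces elements of the Borel subgroup from explicit matrices: a
    triangular matrix with no zero on its diagonal is invertible. *)
Lemma borelK_of (g : 'M[F]_n) :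
  (forall i j, g i j != 0 -> upper_block i = upper_block j /\ (i <= j)%N) ->
  (forall i, g i i != 0) -> exists2 k, k \in B & blockK k = g.
Proof.
move=> gB gd.
have unit_trig m (h : 'M[F]_m) :
    (forall i j, h i j != 0 -> (i <= j)%N) -> (forall i, h i i != 0) ->
      h \in unitmx.
  move=> tr d; rewrite unitmxE -det_tr det_trig; last first.
    by apply/is_trig_mxP => i j ij; rewrite mxE; apply/eqP; apply:
      contraLR ij => /tr; rewrite -leqNgt.
  by rewrite unitfE; apply/prodf_neq0 => i _; rewrite mxE.
have ul : ulsubmx g \in unitmx.
  by apply: unit_trig => i => [j|]; rewrite mxE mxE // => /gB [].
have dr : drsubmx g \in unitmx.
  by apply: unit_trig => i => [j|]; rewrite mxE mxE // => /gB [];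
    rewrite /= leq_add2l.
pose k : K := (Sub (ulsubmx g) ul, Sub (drsubmx g) dr).
have kE : blockK k = g.
  rewrite -[RHS]submxK /blockK; congr block_mx; apply/matrixP => i j;
    rewrite !mxE;
    apply/esym/eqP; apply: contraT => /gB [];
    by rewrite !(upper_block_l, upper_block_r).
by exists k => //; apply/borelKP; rewrite kE.
Qed.

Lemma borelK_diag (k : K) i : k \in B -> blockK k i i != 0.
Proof.
move=> /borelKP kB; have : \det (blockK k)^T != 0.
  by rewrite det_tr -unitfE -unitmxE blockK_unit.
rewrite det_trig; first by move=> /prodf_neq0 /(_ i isT); rewrite mxE.
by apply/is_trig_mxP => x j ij; rewrite mxE; apply/eqP; apply: contraLR ij =>
  /kB [_]; rewrite -leqNgt.
Qed.

End Borel.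

(** * Column spans *)

Section ColumnSpan.

Variables (F : finFieldType) (n r : nat).
Implicit Types t u : 'M[F]_(n, r).

Lemma mem_colspan t (v : 'cV_n) :
  reflect (exists x, v = t *m x) (v \in colspan t).
Proof.
have col_mem j : col j t \in colspan t by apply/memv_span/image_f.
apply: (iffP idP) => [|[x ->]]; last first.
  have -> : t *m x = \sum_j x j 0 *: col j t.
    apply/colP => i; rewrite summxE !mxE; apply: eq_bigr => j _.
    by rewrite !mxE mulrC.
  by apply: memv_suml => j _; apply: memvZ.
have colE j : col j t = t *m delta_mx j 0 by rewrite colE.
have : (colspan t <= linfun (mulmx t) @: fullv)%VS.
  apply/span_subvP => w /imageP [j _ ->].
  by apply/memv_imgP; exists (delta_mx j 0); rewrite ?memvf // lfunE /= colE.
by move=> /subvP sub /sub /memv_imgP [x _ ->]; exists x; rewrite lfunE.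
Qed.

Lemma colspan_limg (g : 'M[F]_n) t :
  (linfun (mulmx g) @: colspan t)%VS = colspan (g *m t).
Proof.
apply/vspaceP => v; apply/memv_imgP/mem_colspan =>
  [[w /mem_colspan [x ->] ->]|[x ->]].
  by exists x; rewrite lfunE /= mulmxA.
by exists (t *m x); [apply/mem_colspan; exists x | rewrite lfunE /= mulmxA].
Qed.

Lemma colspan_mulr t (h : 'M_r) : h \in unitmx -> colspan (t *m h) = colspan t.
Proof.
move=> hU; apply/vspaceP => v; apply/mem_colspan/mem_colspan => [[x ->]|[x ->]].
  by exists (h *m x); rewrite mulmxA.
by exists (invmx h *m x); rewrite -mulmxA mulKVmx.
Qed.

(** The Grassmannian is the quotient of the matrices of rank r by the right
    action of GL_r. *)
Lemma colspan_eqP t u : \rank t = r -> colspan t = colspan u ->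
  exists2 h, h \in unitmx & t = u *m h.
Proof.
move=> rank_t eq_tu.
have col_in j : exists x : 'cV_r, col j t == u *m x.
  have /mem_colspan [x ->] : col j t \in colspan u.
    by rewrite -eq_tu; apply/memv_span/image_f.
  by exists x.
pose h : 'M_r := \matrix_(i, j) xchoose (col_in j) i 0.
have th : t = u *m h.
  apply/matrixP => i j; have /eqP /colP /(_ i) := xchooseP (col_in j).
  by rewrite !mxE => ->; apply: eq_bigr => k _; rewrite !mxE.
exists h => //; rewrite -row_full_unit /row_full eqn_leq rank_leq_row /=.
by rewrite -[X in (X <= _)%N]rank_t th mxrankM_maxr.
Qed.

Lemma colspan_exists (V : {vspace 'cV[F]_n}) : \dim V = r ->
  exists2 t : 'M_(n, r), colspan t = V & \rank t = r.
Proof.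
move=> dimV; pose b j := (vbasis V)`_(nat_of_ord (j : 'I_r)).
pose t : 'M[F]_(n, r) := \matrix_(i, j) b j i 0.
have colt j : col j t = b j by apply/colP => i; rewrite !mxE.
exists t.
  rewrite -(span_basis (vbasisP V)); congr (span _).
  apply: (@eq_from_nth _ 0); rewrite size_map -cardE card_ord ?size_tuple //
    => i ir.
  rewrite (nth_map (Ordinal ir)) -?cardE ?card_ord // colt /b.
  by congr (_`_ _); rewrite nth_enum_ord.
rewrite -mxrank_tr; apply/eqP; rewrite -/(row_free _) -kermx_eq0.
apply/eqP/row_matrixP => k; rewrite row0; set v := row k _.
have vt0 : v *m t^T = 0 by rewrite -row_mul mulmx_ker row0.
have /freeP free_b := basis_free (vbasisP V).
have v0 : forall i, v 0 (cast_ord dimV i) = 0.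
  apply: free_b; apply/colP => i; move/rowP/(_ i): vt0; rewrite !mxE => <-.
  rewrite summxE [RHS](reindex (cast_ord dimV)); last first.
    by exists (cast_ord (esym dimV)) => l _; rewrite ?cast_ordK ?cast_ordKV.
  by apply: eq_bigr => l _; rewrite !mxE.
by apply/rowP => i; rewrite [RHS]mxE -(cast_ordKV dimV i) v0.
Qed.

End ColumnSpan.

(** * Every orbit contains a parameter *)

Section Orbits.

Variables (F : finFieldType) (p q r : nat).
Local Notation n := (p.+1 + q.+1)%N.
Local Notation K := (grpK F p q).
Local Notation B := (borelK F p q).
Implicit Types M N : 'M[F]_(n, r).

(** Orbits of the Borel subgroup on the Grassmannian, lifted to orbits of
    B x GL_r on matrices, where row and column operations are available. *)
Definition same_orbit M N : Prop :=
  exists k h, [/\ k \in B, h \in unitmx & M = blockK k *m N *m h].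

Lemma same_orbit_refl M : same_orbit M M.
Proof.
by exists 1%g, 1%:M; rewrite borelK_1 unitmx1 blockK1 mul1mx mulmx1.
Qed.

Lemma same_orbit_sym M N : same_orbit M N -> same_orbit N M.
Proof.
move=> [k [h [kB hU ->]]]; exists k^-1%g, (invmx h).
by rewrite borelK_V // unitmx_inv hU !mulmxA blockKV mul1mx mulmxK.
Qed.

Lemma same_orbit_trans M N N' :
  same_orbit M N -> same_orbit N N' -> same_orbit M N'.
Proof.
move=> [k [h [kB hU ->]]] [l [g [lB gU ->]]]; exists (k * l)%g, (g *m h).
by rewrite borelK_M // unitmx_mul gU hU blockKM !mulmxA.
Qed.

Lemma same_orbit_rank M N : same_orbit M N -> \rank M = \rank N.
Proof.
move=> [k [h [_ hU ->]]]; rewrite mxrankMfree ?row_free_unit //.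
by rewrite eqmxMfull // row_full_unit blockK_unit.
Qed.

Lemma borel_transvection (u : 'cV[F]_n) (w : 'rV[F]_n) :
  (forall i j, u i 0 != 0 -> w 0 j != 0 ->
     upper_block i = upper_block j /\ (i <= j)%N) ->
  (forall i, 1 + u i 0 * w 0 i != 0) ->
  exists2 k, k \in B &
    forall m (M : 'M_(n, m)), blockK k *m M = M + u *m (w *m M).
Proof.
move=> uwB uw1; have [||k kB kE] := @borelK_of F p q (1%:M + u *m w).
- move=> i j; rewrite !mxE big_ord1; case: (eqVneq i j) => [-> // | _].
  by rewrite add0r mulf_eq0 => /norP [ui wj]; apply: uwB.
- by move=> i; rewrite !mxE big_ord1 eqxx; apply: uw1.
by exists k => // m M; rewrite kE mulmxDl mul1mx mulmxA.
Qed.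

Lemma transvection_unit j (w : 'rV[F]_r) : w 0 j = 0 ->
  1%:M + delta_mx j 0 *m w \in unitmx.
Proof.
move=> wj; suff /mulmx1_unit [] :
  (1%:M + delta_mx j 0 *m w) *m (1%:M - delta_mx j 0 *m w) = 1%:M by [].
have wd : w *m delta_mx j 0 = 0 :> 'M_1.
  by rewrite -colE; apply/matrixP => a b; rewrite !mxE !ord1 wj.
rewrite mulmxDl mul1mx mulmxBr mulmx1 !mulmxA.
by rewrite -[_ *m w *m _]mulmxA wd mulmx0 mul0mx subr0 subrK.
Qed.

Lemma same_orbit_colop j (w : 'rV_r) N :
  w 0 j = 0 -> same_orbit (N + col j N *m w) N.
Proof.
move=> wj; exists 1%g, (1%:M + delta_mx j 0 *m w).
rewrite borelK_1 transvection_unit // blockK1 mul1mx mulmxDr mulmx1.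
by rewrite mulmxA -colE.
Qed.

Lemma same_orbit_rowop i (u : 'cV_n) N :
  (forall k, u k 0 != 0 -> upper_block k = upper_block i /\ (k <= i)%N) ->
  1 + u i 0 != 0 -> same_orbit (N + u *m row i N) N.
Proof.
move=> uB ui; have [k j|k|g gB gE] := @borel_transvection u (delta_mx 0 i).
- move=> /uB [-> ki]; rewrite mxE eqxx /=.
  by case: (eqVneq j i) => [-> | _]; rewrite ?eqxx.
- rewrite mxE eqxx /=.
  by case: (eqVneq k i) => [-> | _]; rewrite (mulr1, mulr0) ?addr0 ?oner_eq0.
by exists g, 1%:M; rewrite gB unitmx1 mulmx1 gE -rowE.
Qed.

Definition column_key m (A : 'M[F]_(m, r)) (j : 'I_r) : nat :=
  \max_(i | (A i j != 0)%R) i.+1.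

(** A column operation that respects the order of the pivots of the upper block
    can be applied to the lower block alone. Its effect on the upper block is to
    add w to the pivot row of column j; the columns in the support of w have
    their pivots further down, so w is a combination of lower rows, and an upper
    triangular row operation on the upper block removes it. *)
Lemma lower_colop_same_orbit (A1 : 'M_(p.+1, r)) (A2 : 'M_(q.+1, r))
    j (w : 'rV_r) :
  is_partial_perm_mx A1 -> w 0 j = 0 ->
  (forall k, w 0 k != 0 -> (column_key A1 j <= column_key A1 k)%N) ->
  same_orbit (col_mx A1 (A2 + col j A2 *m w)) (col_mx A1 A2).
Proof.
move=> /partial_perm_mxP [A1one A1row A1col] wj wkey.
have keyE i c : A1 i c != 0 -> column_key A1 c = i.+1.
  move=> Aic; rewrite /column_key (bigD1 i) //= big1 ?maxn0 // => k /andP [Akc].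
  by rewrite (A1col _ _ _ Akc Aic) eqxx.
apply: same_orbit_trans (same_orbit_colop _ wj); apply: same_orbit_sym.
have -> : col_mx A1 A2 + col j (col_mx A1 A2) *m w
    = col_mx (A1 + col j A1 *m w) (A2 + col j A2 *m w).
  by rewrite col_col_mx mul_col_mx add_col_mx.
have [/existsP [i Aij] | /existsPn Aj0] := boolP [exists i, A1 i j != 0]; last
  first.
  have -> : col j A1 = 0.
    by apply/colP => i; rewrite !mxE; apply/eqP; rewrite -[_ == _]negbK.
  by rewrite mul0mx addr0; apply: same_orbit_refl.
have colj : col j A1 = delta_mx i 0.
  apply/colP => k; rewrite !mxE andbT; case: (eqVneq k i) => [-> | ki].
    exact: A1one.
  by apply/eqP; apply: contraNT ki => Akj; rewrite (A1col _ _ _ Akj Aij).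
(* v carries the entry of w in column c to the pivot row of column c *)
pose v := w *m A1^T.
have vE k c : A1 k c != 0 -> v 0 k = w 0 c.
  move=> Akc; rewrite mxE (bigD1 c) //= mxE (A1one _ _ Akc) mulr1.
  rewrite big1 ?addr0 // => d dc; rewrite mxE.
  case: (eqVneq (A1 k d) 0) => [-> | Akd]; first by rewrite mulr0.
  by rewrite (A1row _ _ _ Akd Akc) eqxx in dc.
(* w is supported on nonzero columns, since their keys are at least i.+1 *)
have vA : v *m A1 = w.
  apply/rowP => c; rewrite mxE.
  rewrite (eq_bigr (fun k => w 0 c * A1 k c)) => [|k _]; last first.
    by case: (eqVneq (A1 k c) 0) => [-> | /vE ->]; rewrite ?mulr0.
  rewrite -mulr_sumr; case: (eqVneq (w 0 c) 0) => [-> | wc];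
    first by rewrite mul0r.
  have [k Akc] : exists k, A1 k c != 0.
    apply/existsP; apply: contraT => /existsPn z.
    have := wkey c wc; rewrite (keyE _ _ Aij) /column_key big_pred0 // => k.
    by apply/negbTE/z.
  rewrite (bigD1 k) //= (A1one _ _ Akc) big1 ?addr0 ?mulr1 // => l lk.
  by apply/eqP; apply: contraNT lk => Alc; rewrite (A1col _ _ _ Alc Akc).
have [x y|x|g gB gE] :=
  @borel_transvection (col_mx (delta_mx i 0) 0) (row_mx v 0).
- case: (split_ordP x) => x' ->; last by rewrite col_mxEd mxE eqxx.
  case: (split_ordP y) => y' ->; last first.
    by rewrite row_mxEr [X in _ -> X != _ -> _]mxE eqxx.
  rewrite col_mxEu row_mxEl !upper_block_l mxE andbT.
  case: (eqVneq x' i) => [-> _ | _]; last by rewrite eqxx.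
  have [/existsP [c Ayc] | /existsPn z] := boolP [exists c, A1 y' c != 0].
    by rewrite (vE _ _ Ayc) => /wkey; rewrite (keyE _ _ Aij) (keyE _ _ Ayc).
  rewrite mxE big1 ?eqxx // => c _; rewrite mxE.
  by move: (z c); rewrite negbK => /eqP ->; rewrite mulr0.
- case: (split_ordP x) => x' ->; last first.
    by rewrite col_mxEd mxE mul0r addr0 oner_eq0.
  rewrite col_mxEu row_mxEl mxE andbT.
  case: (eqVneq x' i) => [-> | _]; last by rewrite mul0r addr0 oner_eq0.
  by rewrite (vE _ _ Aij) wj mulr0 addr0 oner_eq0.
exists g, 1%:M; rewrite gB unitmx1 mulmx1 gE mul_row_col mul0mx addr0 vA.
by rewrite mul_col_mx mul0mx add_col_mx addr0 colj.
Qed.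

(** Elimination is run twice: on the upper block with all column operations,
    then on the lower block with only those that the upper block, already in
    normal form, can absorb. *)
Lemma normal_form M :
  \rank M = r -> exists t : param F p q r, same_orbit M (val t).
Proof.
suff main (A1 : 'M[F]_(p.+1, r)) : forall A2 : 'M[F]_(q.+1, r),
    \rank (col_mx A1 A2) = r ->
    exists t : param F p q r, same_orbit (col_mx A1 A2) (val t).
  by rewrite -[M]vsubmxK; apply: main.
clear M; have move_to M N : same_orbit N M ->
    (\rank N = r -> exists t : param F p q r, same_orbit N (val t)) ->
    \rank M = r -> exists t : param F p q r, same_orbit M (val t).
  move=> NM goodN rM; have [|t Nt] := goodN;
    first by rewrite (same_orbit_rank NM).
  by exists t; apply: same_orbit_trans Nt; apply: same_orbit_sym.
pose free_key (j : 'I_r) := 0%N.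
move: A1; apply: (@elimination F p.+1 r free_key) =>
  [i u A1 ui u1 IH A2|j w A1 wj _ IH A2|A1 A1perm].
- apply: (move_to _ (col_mx (A1 + u *m row i A1) A2)); last exact: IH.
  have -> : col_mx (A1 + u *m row i A1) A2
      = col_mx A1 A2 + col_mx u 0 *m row (lshift q.+1 i) (col_mx A1 A2).
    by rewrite mul_col_mx mul0mx add_col_mx addr0 rowKu.
  apply: same_orbit_rowop => [k|]; last by rewrite col_mxEu.
  case: (split_ordP k) => k' ->; last by rewrite col_mxEd mxE eqxx.
  by rewrite col_mxEu !upper_block_l => /ui.
- apply: (move_to _ (col_mx (A1 + col j A1 *m w) (A2 + col j A2 *m w))).
    have -> : col_mx (A1 + col j A1 *m w) (A2 + col j A2 *m w)
        = col_mx A1 A2 + col j (col_mx A1 A2) *m w.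
      by rewrite col_col_mx mul_col_mx add_col_mx.
    exact: same_orbit_colop.
  exact: IH.
apply: (@elimination F q.+1 r (column_key A1)) =>
  [i u A2 ui u1 IH|j w A2 wj wkey IH|A2 A2perm].
- apply: (move_to _ (col_mx A1 (A2 + u *m row i A2))); last exact: IH.
  have -> : col_mx A1 (A2 + u *m row i A2)
      = col_mx A1 A2 + col_mx 0 u *m row (rshift p.+1 i) (col_mx A1 A2).
    by rewrite mul_col_mx mul0mx add_col_mx addr0 rowKd.
  apply: same_orbit_rowop => [k|]; last by rewrite col_mxEd.
  case: (split_ordP k) => k' ->; first by rewrite col_mxEu mxE eqxx.
  by rewrite col_mxEd !upper_block_r /= leq_add2l => /ui.
- apply: (move_to _ (col_mx A1 (A2 + col j A2 *m w))); last exact: IH.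
  exact: lower_colop_same_orbit.
move=> rank_r.
have pt : is_param (col_mx A1 A2).
  by rewrite /is_param col_mxKu col_mxKd A1perm A2perm rank_r eqxx.
by exists (Sub _ pt); apply: same_orbit_refl.
Qed.

End Orbits.

(** * Distinct parameters lie in distinct orbits *)

Section Separation.

Variables (F : finFieldType) (p q r : nat).
Local Notation n := (p.+1 + q.+1)%N.
Implicit Types t u : param F p q r.

Lemma paramP t :
  [/\ forall i j, val t i j != 0 -> val t i j = 1,
      forall i j k, val t i j != 0 -> val t i k != 0 -> j = k
    & forall i k j, upper_block i = upper_block k ->
        val t i j != 0 -> val t k j != 0 -> i = k].
Proof.
have /and3P [/partial_perm_mxP [t1 row1 col1] /partial_perm_mxP [t2 row2 col2]
  _] := valP t.
have up i j : usubmx (val t) i j = val t (lshift q.+1 i) j by rewrite mxE.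
have dn i j : dsubmx (val t) i j = val t (rshift p.+1 i) j by rewrite mxE.
split=> [i j|i j k|i k j].
- case: (split_ordP i) => i' ->; rewrite -?up -?dn; [exact: t1 | exact: t2].
- case: (split_ordP i) => i' ->; rewrite -?up -?dn; [exact: row1 | exact: row2].
case: (split_ordP i) => i' ->; case: (split_ordP k) => k' ->;
  rewrite ?upper_block_l ?upper_block_r -?up -?dn // => _ ti tk.
- by rewrite (col1 _ _ _ ti tk).
- by rewrite (col2 _ _ _ ti tk).
Qed.

(** The row of the 1 of column j in the block b, shifted by one so that 0 means
    that there is none. *)
Definition pivot t (b : bool) (j : 'I_r) : nat :=
  \max_(i : 'I_n | (upper_block i == b) && (val t i j != 0)%R) i.+1.

Lemma pivotE t i j : val t i j != 0 -> pivot t (upper_block i) j = i.+1.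
Proof.
move=> tij; have [_ _ tcol] := paramP t.
rewrite /pivot (bigD1 i) ?eqxx //= big1 ?maxn0 // =>
  k /andP [/andP [/eqP ki tkj]].
by rewrite (tcol _ _ _ ki tkj tij) eqxx.
Qed.

Lemma pivot_inv t b (i : 'I_n) j : pivot t b j = i.+1 -> upper_block i =
  b /\ val t i j != 0.
Proof.
rewrite /pivot => piv; have [/existsP [k /andP [/eqP kb tkj]] | /existsPn z] :=
  boolP [exists k, (upper_block k == b) && (val t k j != 0)]; last first.
  by move: piv; rewrite big_pred0 // => k; apply/negbTE/z.
move: piv; rewrite -/(pivot t b j) -kb pivotE // => -[/val_inj <-].
by split.
Qed.

(** Write t = k u h. Since det h is nonzero, some permutation s has h j (s j)
    nonzero for all j. The row of k^-1 t = u h at the pivot of column j of u is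
    the row j of h, so it is nonzero at s j; as k^-1 is upper triangular,
    column s j of t has a nonzero entry at that row or below it. *)
Lemma same_orbit_pivot_le t u : same_orbit (val t) (val u) ->
  exists s : 'S_r, forall b j, (pivot u b j <= pivot t b (s j))%N.
Proof.
move=> [k [h [kB hU tE]]].
have [s hs] : exists s : 'S_r, forall j, h j (s j) != 0.
  have : \det h != 0 by rewrite -unitfE -unitmxE.
  rewrite /determinant => /eqP det_h.
  have [s ps] : exists s : 'S_r, \prod_i h i (s i) != 0.
    apply/existsP; apply: contra_notT det_h => /existsPn z.
    by apply: big1 => s _; move: (z s); rewrite negbK => /eqP ->; rewrite mulr0.
  by exists s => j; apply: (prodf_neq0 _ _ ps).
exists s => b j; case piv: (pivot u b j) => [//|i].
have i_lt : (i < n)%N.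
  have : (pivot u b j <= n)%N by apply/bigmax_leqP => x _; apply: ltn_ord.
  by rewrite piv.
have [ib uij] := @pivot_inv u b (Ordinal i_lt) j piv.
have [u1 urow _] := paramP u.
have : (blockK k^-1%g *m val t) (Ordinal i_lt) (s j) != 0.
  rewrite tE -!mulmxA mulmxA blockKV mul1mx mxE (bigD1 j) //= u1 // mul1r.
  rewrite big1 ?addr0 // => l lj.
  case: (eqVneq (val u (Ordinal i_lt) l) 0) => [-> | ul];
    first by rewrite mul0r.
  by rewrite (urow _ _ _ ul uij) eqxx in lj.
rewrite mxE => /eqP nz.
have [x /andP [kx tx]] : exists x, (blockK k^-1%g (Ordinal i_lt) x != 0) &&
  (val t x (s j) != 0).
  apply/existsP; apply: contra_notT nz => /existsPn z; apply: big1 => x _.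
  by have := z x; rewrite negb_and !negbK => /orP [] /eqP ->;
    rewrite ?mul0r ?mulr0.
have /borelKP kVB := borelK_V kB.
have [xb ix] := kVB _ _ kx.
by rewrite -ib xb pivotE.
Qed.

(** The previous lemma applies in both directions. Summing the pivot rows over
    all columns shows that the inequalities are equalities, so the permutation
    s matches the columns of t with those of u. *)
Lemma same_orbit_col_equiv t u : same_orbit (val t) (val u) -> col_equiv t u.
Proof.
move=> tu; have [s le_ut] := same_orbit_pivot_le tu.
have [s' le_tu] := same_orbit_pivot_le (same_orbit_sym tu).
have eq_piv b j : pivot u b j = pivot t b (s j).
  have sum_eq : (\sum_j pivot u b j == \sum_j pivot t b (s j))%N.
    rewrite eqn_leq leq_sum //= -(reindex_inj (P := predT) (F :=
      pivot t b) (@perm_inj _ s)) /=.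
    by rewrite [leqRHS](reindex_inj (@perm_inj _ s')) leq_sum.
  have [_] := leqif_sum (fun j (_ : true) => leqif_eq (le_ut b j)).
  by rewrite sum_eq => /esym/forallP/(_ j)/eqP.
apply/existsP; exists s; apply/eqP/matrixP => i j; rewrite mxE.
have [t1 _ _] := paramP t; have [u1 _ _] := paramP u.
have [tz | tnz] := eqVneq (val t i (s j)) 0.
  rewrite tz; apply/eqP; apply: contraT => uij.
  have := pivotE uij; rewrite eq_piv => /pivot_inv [_].
  by rewrite tz eqxx.
rewrite t1 // u1 //.
have := pivotE tnz; rewrite -eq_piv => /pivot_inv [_ //].
Qed.

Lemma col_equiv_same_orbit t u : col_equiv t u -> same_orbit (val u) (val t).
Proof.
move=> /existsP [s /eqP ->]; rewrite col_permE.
exists 1%g, (perm_mx s^-1); rewrite borelK_1 unitmx_perm blockK1 mul1mx.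
by split.
Qed.

Lemma same_orbit_classP t u :
  reflect (same_orbit (val t) (val u)) (param_class t == param_class u).
Proof.
apply: (iffP eqP) => [/eqmodP /= tu | /same_orbit_col_equiv tu].
  exact/same_orbit_sym/col_equiv_same_orbit.
by apply/eqmodP.
Qed.

End Separation.

(** * The space of invariant functions *)

(** A B-invariant function f on X extends to the K-invariant function
    (kB, x) |-> f (k^-1 x) on K/B x X. The representative chosen in each coset
    does not matter by invariance. *)
Section CosetFunction.

Variables (C : fieldType) (K : finGroupType) (B : {group K}) (X : Type).
Variable act : K -> X -> X.
Hypothesis act1 : forall x, act 1%g x = x.
Hypothesis actM : forall k l x, act (k * l)%g x = act k (act l x).
Variable f : X -> C.
Hypothesis fB : invariant_fun act B f.

Lemma repr_lcoset (A : {set K}) :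
  A \in lcosets B [set: K] -> repr A \in A /\ A = (repr A *: B)%g.
Proof.
move=> /lcosetsP [x _ ->]; have xB := mem_repr x (lcoset_refl B x).
by split; rewrite ?(lcoset_eqP xB).
Qed.

Definition coset_fun (A : {set K}) (x : X) : C := f (act (repr A)^-1%g x).

Lemma coset_funE (A : {set K}) k x : A \in lcosets B [set: K] -> k \in A ->
  coset_fun A x = f (act k^-1%g x).
Proof.
move=> /repr_lcoset [_ AE]; rewrite {1}AE => /lcosetP [b bB ->].
by rewrite invMg actM fB ?groupV.
Qed.

Lemma coset_fun_act (A : {set K}) k x : A \in lcosets B [set: K] ->
  coset_fun (k *: A)%g (act k x) = coset_fun A x.
Proof.
move=> AB; have [rA _] := repr_lcoset AB.
rewrite (coset_funE (k := (k * repr A)%g)) ?mem_lcoset ?mulKg //.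
  by rewrite invMg actM -(actM k^-1%g) mulVg act1.
have /lcosetsP [y _ ->] := AB; apply/lcosetsP; exists (k * y)%g;
  rewrite ?inE //.
by rewrite lcosetM.
Qed.

Lemma coset_fun_base x : coset_fun B x = f x.
Proof.
rewrite (coset_funE (k := 1%g)) ?group1 ?invg1 ?act1 //.
by apply/lcosetsP; exists 1%g; rewrite ?inE ?mul1g.
Qed.

End CosetFunction.

Section Grassmannian.

Variables (F : finFieldType) (p q r : nat).
Local Notation n := (p.+1 + q.+1)%N.
Local Notation K := (grpK F p q).
Local Notation B := (borelK F p q).
Implicit Types (t u : param F p q r) (V : Gr F p q r).

Lemma Gr_act1 V : Gr_act 1%g V = V.
Proof.
apply: val_inj; apply/vspaceP => v /=; rewrite blockK1.
apply/memv_imgP/idP => [[w wV ->]|vV]; first by rewrite lfunE /= mul1mx.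
by exists v; rewrite // lfunE /= mul1mx.
Qed.

Lemma Gr_actM (k l : K) V : Gr_act (k * l)%g V = Gr_act k (Gr_act l V).
Proof.
apply: val_inj; rewrite /= -limg_comp; congr (_ @: _)%VS.
by apply/lfunP => v; rewrite comp_lfunE !lfunE /= blockKM mulmxA.
Qed.

Lemma Gr_act_span (k : K) t : val (Gr_act k (param_span t)) =
  colspan (blockK k *m val t).
Proof. exact: colspan_limg. Qed.

Lemma param_rank t : \rank (val t) = r.
Proof. by have /and3P [_ _ /eqP] := valP t. Qed.

Lemma in_param_orbitP t V (M : 'M_(n, r)) : colspan M = val V -> \rank M = r ->
  reflect (same_orbit M (val t)) (in_param_orbit t V).
Proof.
move=> MV rM; apply: (iffP existsP) => [[b /andP [bB /eqP Vb]]|[b [h [bB hU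
  Mb]]]].
  have [h hU Mh] : exists2 h, h \in unitmx & M = blockK b *m val t *m h.
    by apply: colspan_eqP => //; rewrite MV Vb Gr_act_span.
  by exists b, h.
exists b; rewrite bB /=; apply/eqP/val_inj.
by rewrite Gr_act_span -MV Mb colspan_mulr.
Qed.

(** The orbit of k [t] is found by bringing the matrix k t to normal form. *)
Lemma in_param_orbit_act t u (k : K) :
  same_orbit (blockK k *m val t) (val u) ->
  forall s, in_param_orbit s (Gr_act k (param_span t)) =
    (param_class u == param_class s).
Proof.
move=> ktu s; have rk : \rank (blockK k *m val t) = r.
  by rewrite eqmxMfull ?param_rank // row_full_unit blockK_unit.
have P := @in_param_orbitP s _ _ (esym (Gr_act_span k t)) rk.
apply/P/same_orbit_classP => [|us].
  exact: same_orbit_trans (same_orbit_sym ktu).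
exact: same_orbit_trans us.
Qed.

Lemma Gr_normal_form V : exists k t, k \in B /\ V = Gr_act k (param_span t).
Proof.
have [M MV rM] := colspan_exists (eqP (valP V)).
have [t [k [h [kB hU Mt]]]] := normal_form rM.
exists k, t; split=> //; apply: val_inj.
by rewrite Gr_act_span -MV Mt colspan_mulr.
Qed.

Lemma param_class_repr (c : paramQ F p q r) :
  param_class (generic_quotient.repr c) = c.
Proof. exact: reprK. Qed.

Variable C : fieldType.

Lemma xi_span (c : paramQ F p q r) t : xi C c (param_span t) =
  (param_class t == c)%:R.
Proof.
rewrite /xi -[param_span t]Gr_act1 (@in_param_orbit_act t t) ?param_class_repr
  //.
by rewrite blockK1 mul1mx; apply: same_orbit_refl.
Qed.

Lemma xi_act (c : paramQ F p q r) t u (k : K) :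
  same_orbit (blockK k *m val t) (val u) ->
  xi C c (Gr_act k (param_span t)) = (param_class u == c)%:R.
Proof. by move=> ktu; rewrite /xi (in_param_orbit_act ktu) param_class_repr.
  Qed.

Lemma same_orbit_borel (k : K) t : k \in B ->
  same_orbit (blockK k *m val t) (val t).
Proof. by move=> kB; exists k, 1%:M; rewrite kB unitmx1 mulmx1. Qed.

Lemma xi_invariant (c : paramQ F p q r) : invariant_fun Gr_act B (xi C c).
Proof.
move=> k V kB; have [l [t [lB ->]]] := Gr_normal_form V.
by rewrite -Gr_actM !(xi_act _ (same_orbit_borel _ _)) ?borelK_M.
Qed.

(** Every orbit contains some [t], so identities between invariant functions
    are checked on these points. *)
Lemma invariant_ext (f g : Gr F p q r -> C) :
  invariant_fun Gr_act B f -> invariant_fun Gr_act B g ->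
  (forall t, f (param_span t) = g (param_span t)) -> f =1 g.
Proof.
by move=> fB gB fg V; have [k [t [kB ->]]] := Gr_normal_form V; rewrite fB //
  gB.
Qed.

Lemma sum_xi_span (a : {ffun paramQ F p q r -> C}) t :
  \sum_c a c * xi C c (param_span t) = a (param_class t).
Proof.
rewrite (bigD1 (param_class t)) //= xi_span eqxx mulr1 big1 ?addr0 // => c ct.
by rewrite xi_span eq_sym (negPf ct) mulr0.
Qed.

Lemma xi_basis (f : Gr F p q r -> C) : invariant_fun Gr_act B f ->
  exists! a : {ffun paramQ F p q r -> C}, forall V, f V = \sum_c a c * xi C c V.
Proof.
move=> fB; exists [ffun c : paramQ F p q r =>
  f (param_span (generic_quotient.repr c))]; split.
  apply: invariant_ext => // [k V kB | t].
    by apply: eq_bigr => c _; rewrite xi_invariant.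
  rewrite sum_xi_span ffunE; have /same_orbit_classP [k [h [kB hU E]]] :
      param_class t == param_class (generic_quotient.repr (param_class t)).
    by rewrite param_class_repr.
  rewrite -[RHS](fB k) //; congr f; apply: val_inj; rewrite Gr_act_span /= E.
  by rewrite colspan_mulr.
move=> a fa; apply/ffunP => c; rewrite ffunE fa sum_xi_span.
by rewrite param_class_repr.
Qed.

Lemma flag_lcoset (c : flagK F p q) :
  val c \in lcosets (borelK_group F p q) [set: K].
Proof. exact (valP c). Qed.

Lemma flag_repr (c : flagK F p q) :
  c = flag_act (repr (val c)) (flag_base F p q).
Proof. apply: val_inj; exact (proj2 (repr_lcoset (flag_lcoset c))). Qed.

Lemma base_restr_invariant (Phi : doubleflag F p q r -> C) :
  invariant_fun doubleflag_act [set: K] Phi ->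
  invariant_fun Gr_act B (base_restr Phi).
Proof.
move=> PhiK k V kB; rewrite /base_restr -[RHS](PhiK k) ?inE //.
congr (Phi (_, _)); apply: val_inj; rewrite /=.
by rewrite lcoset_id.
Qed.

Lemma base_restr_extension (f : Gr F p q r -> C) :
  invariant_fun Gr_act B f ->
  exists Phi : doubleflag F p q r -> C,
    [/\ invariant_fun doubleflag_act [set: K] Phi, base_restr Phi =1 f
      & forall Psi : doubleflag F p q r -> C,
          invariant_fun doubleflag_act [set: K] Psi ->
          base_restr Psi =1 f -> Psi =1 Phi].
Proof.
move=> fB; exists (fun z => coset_fun Gr_act f (val z.1) z.2); split.
- move=> k [c V] _.
  exact: (coset_fun_act (B := borelK_group F p q) Gr_act1 Gr_actM fB k V
    (flag_lcoset c)).
- exact: (coset_fun_base (B := borelK_group F p q) Gr_act1 Gr_actM fB).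
move=> Psi PsiK Psif [c V].
have PsiE k : Psi (flag_act k (flag_base F p q), V) = f (Gr_act k^-1%g V).
  rewrite -Psif -{1}(Gr_act1 V) -(mulgV k) Gr_actM.
  exact (PsiK k (flag_base F p q, Gr_act k^-1%g V) (in_setT k)).
exact (etrans (congr1 (fun d => Psi (d, V)) (flag_repr c)) (PsiE (repr (val
  c)))).
Qed.

End Grassmannian.

(** * The three cases in terms of row labels *)

Section Labels.

Variables (F : finFieldType) (p q r : nat).
Local Notation n := (p.+1 + q.+1)%N.
Implicit Types (t : param F p q r) (i k : 'I_n) (v : vertex p.+1 q.+1).

(** For rows i, k in opposite blocks: an edge of the graph of t. *)
Definition linked (t : 'M[F]_(n, r)) i k : bool :=
  [exists c, (t i c != 0) && (t k c != 0)].

(** One number per vertex records everything that the case distinction uses: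
    0 for a marked vertex, the position (plus one) of the other end for the
    endpoint of an edge, and n + 1, larger than all these positions, for a
    vertex of degree 0. For consecutive vertices v before v' of the same sign,
    cases (I), (II), (III) say that the label of v is equal to, larger than,
    smaller than the label of v'. *)
Definition label (t : 'M[F]_(n, r)) i : nat :=
  if [exists c, t i c != 0]
  then \max_(k | (upper_block k != upper_block i) && linked t i k) k.+1
  else n.+1.

Lemma label_zero (t : 'M[F]_(n, r)) i : (forall c, t i c = 0) -> label t i =
  n.+1.
Proof.
by move=> ti; rewrite /label; case: existsP => // -[c]; rewrite ti eqxx.
Qed.

Lemma label_linked t i k c : val t i c != 0 -> val t k c != 0 ->
  upper_block k != upper_block i -> label (val t) i = k.+1.
Proof.
move=> ti tk ki; have [_ trow tcol] := paramP t.
have ik : linked (val t) i k by apply/existsP; exists c; rewrite ti.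
rewrite /label (introT existsP (ex_intro _ c ti)) (bigD1 k) ?ki //=.
rewrite big1 ?maxn0 // => l /andP [/andP [li /existsP [d /andP [tid tld]]]].
move: tld; rewrite (trow _ _ _ tid ti) => tlc.
rewrite (tcol l k c) ?eqxx //.
by move: li ki; do 3!case: upper_block.
Qed.

Lemma label_alone t i c : val t i c != 0 ->
  (forall k, k != i -> val t k c = 0) -> label (val t) i = 0%N.
Proof.
move=> ti tc; have [_ trow _] := paramP t.
rewrite /label (introT existsP (ex_intro _ c ti)) big1 // => k /andP [ki].
move=> /existsP [d /andP [tid]]; rewrite (trow _ _ _ tid ti) tc ?eqxx //.
by apply: contraNneq ki => ->.
Qed.

Variant label_spec (t : 'M[F]_(n, r)) i : nat -> Prop :=
| LabelZero of (forall c, t i c = 0) : label_spec t i n.+1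
| LabelAlone c of t i c = 1 & (forall k, k != i -> t k c = 0) : label_spec t i 0
| LabelLinked c k of t i c = 1 & t k c = 1 & upper_block k != upper_block i :
    label_spec t i k.+1.

Lemma labelP t i : label_spec (val t) i (label (val t) i).
Proof.
have [t1 trow tcol] := paramP t.
have [/existsP [c tic] | /existsPn z] := boolP [exists c, val t i c != 0];
  last first.
  have ti c : val t i c = 0 by apply/eqP; rewrite -[_ == _]negbK.
  by rewrite label_zero //; constructor.
have [/existsP [k /andP [ki tkc]] | /existsPn z] :=
    boolP [exists k, (k != i) && (val t k c != 0)].
  have bk : upper_block k != upper_block i.
    by apply: contraNneq ki => bki; apply/eqP/(tcol _ _ _ bki tkc tic).
  rewrite (label_linked tic tkc bk).
  exact (LabelLinked (t1 _ _ tic) (t1 _ _ tkc) bk).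
have tc k : k != i -> val t k c = 0.
  by move=> ki; apply/eqP; have := z k; rewrite ki /= negbK.
rewrite (label_alone tic tc); exact (LabelAlone (t1 _ _ tic) tc).
Qed.

Lemma degE t v : deg (val t) v =
  if label (val t) (unsplit v) == n.+1 then 0%N
  else if label (val t) (unsplit v) == 0%N then 2%N else 1%N.
Proof.
rewrite /deg; set i := unsplit v.
have edge_at e : is_edge (val t) e -> endpoint v e -> exists2 k,
    upper_block k != upper_block i & linked (val t) i k.
  move=> /existsP [c /andP [/eqP e1 /eqP e2]]; rewrite /i /linked.
  by case: v @i => [x|y] _ /= /eqP xy;
    [exists (rshift p.+1 e.2) | exists (lshift q.+1 e.1)];
    rewrite ?upper_block_l ?upper_block_r // -?xy;
    apply/existsP; exists c; rewrite e1 e2 oner_eq0.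
have at_edge c k : val t i c = 1 -> val t k c = 1 ->
  upper_block k != upper_block i ->
    exists e, is_edge (val t) e && endpoint v e.
  rewrite /i; case: v @i {edge_at} => [x|y] _ /=; case: (split_ordP k) => z ->
    tx tz;
    rewrite ?upper_block_l ?upper_block_r ?eqxx // => _.
    by exists (x, z); rewrite eqxx andbT; apply/existsP; exists c;
      rewrite tx tz eqxx.
  by exists (z, y); rewrite eqxx andbT; apply/existsP; exists c;
    rewrite tx tz eqxx.
case: (labelP t i) => [tz|c ti tc|c k ti tk ki].
- rewrite eqxx ifN; last first.
    by apply/existsPn => c; apply/forallPn; exists i;
      rewrite tz eqxx [0 == 1]eq_sym oner_eq0.
  rewrite ifN //; apply/existsPn => e; apply/negP => /andP [ee ve].
  have [k _ /existsP [c]] := edge_at e ee ve; by rewrite tz eqxx.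
- rewrite eqxx /= ifT //; apply/existsP; exists c; apply/forallP => k.
  by case: (eqVneq k i) => [-> | /tc ->]; rewrite ?ti ?eqxx //
    [0 == 1]eq_sym oner_eq0.
rewrite eqSS ltn_eqF //= ifN; last first.
  apply/existsPn => d; apply/negP => /forallP dd; have [_ trow _] := paramP t.
  have tid : val t i d = 1 by apply/eqP; rewrite (eqP (dd i)).
  have dc : d = c by apply: (trow i); rewrite ?ti ?tid oner_eq0.
  by have := dd k; rewrite dc tk eqxx eq_sym eqb_id => /eqP kE;
    rewrite kE eqxx in ki.
by rewrite ifT //; apply/existsP; apply: at_edge ti tk ki.
Qed.

Definition far_end (v : vertex p.+1 q.+1) (e : 'I_p.+1 * 'I_q.+1) : 'I_n :=
  if v is inl _ then rshift p.+1 e.2 else lshift q.+1 e.1.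

Lemma label_edge t v e : is_edge (val t) e -> endpoint v e ->
  label (val t) (unsplit v) = (far_end v e).+1.
Proof.
move=> /existsP [c /andP [/eqP e1 /eqP e2]].
case: v => [x|y] => /eqP <-.
  by apply: (@label_linked _ (lshift _ _) (rshift _ _) c);
    rewrite ?e1 ?e2 ?oner_eq0 ?upper_block_l ?upper_block_r.
by apply: (@label_linked _ (rshift _ _) (lshift _ _) c);
  rewrite ?e1 ?e2 ?oner_eq0 ?upper_block_l ?upper_block_r.
Qed.

Lemma label_le t i : (label (val t) i <= n.+1)%N.
Proof. by case: labelP => // c k _ _ _; rewrite ltnS ltnW. Qed.

Lemma label_col_equiv t u : col_equiv t u -> label (val u) =1 label (val t).
Proof.
move=> /existsP [s /eqP ->] i.
have ex_s (P : pred 'I_r) : [exists c, P (s c)] = [exists c, P c].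
  apply/existsP/existsP => -[c Pc]; first by exists (s c).
  by exists (s^-1 c)%g; rewrite permKV.
rewrite /label; congr (if _ then _ else _).
  rewrite -(ex_s (fun c => val t i c != 0)); apply: eq_existsb => c.
  by rewrite mxE.
apply: eq_bigl => k; congr (_ && _); rewrite /linked.
rewrite -(ex_s (fun c => (val t i c != 0) && (val t k c != 0))).
by apply: eq_existsb => c; rewrite !mxE.
Qed.

Section Cases.

Variables (t : param F p q r) (v v' : vertex p.+1 q.+1).
Hypothesis vv' : consecutive v v'.

Lemma consecutive_rows : upper_block (unsplit v) = upper_block (unsplit v')
  /\ unsplit v' = (unsplit v).+1 :> nat.
Proof.
case: v v' vv' => [x|y] [x'|y'] //= /eqP ->;
  by rewrite ?upper_block_l ?upper_block_r ?addnS.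
Qed.

Lemma caseI_label : caseI (val t) v v' ->
  label (val t) (unsplit v) = label (val t) (unsplit v').
Proof.
rewrite /caseI !degE; move: (label _ _) (label _ _) => a b.
case: (eqVneq a n.+1) => [-> | _]; case: (eqVneq b n.+1) => [-> | _] //.
- by case: (eqVneq b 0%N).
- by case: (eqVneq a 0%N).
by case: (eqVneq a 0%N) => [-> | _]; case: (eqVneq b 0%N) => [-> | _].
Qed.

Lemma deg_label_lt w w' : (deg (val t) w < deg (val t) w')%N ->
  (label (val t) (unsplit w') < label (val t) (unsplit w))%N.
Proof.
have := label_le t (unsplit w'); rewrite leq_eqVlt !degE.
move: (label _ (unsplit w)) (label _ (unsplit w')) => a b.
case: (eqVneq a n.+1) => [-> | _]; case: (eqVneq b n.+1) => [-> | _] //=.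
all: try by case: (eqVneq a 0%N).
 by case: (posnP a) => [-> | a0]; case: (posnP b) => [-> | b0].
Qed.

Lemma far_end_cross e f : cross e f -> endpoint v e -> endpoint v' f ->
  (far_end v' f < far_end v e)%N.
Proof.
rewrite /cross /far_end; have := consecutive_rows.
case: v v' vv' => [x|y] [x'|y'] //= /eqP xx' _ /orP [] /andP [ef fe] /eqP ex
  /eqP fx;
  move: ef fe; rewrite ex fx xx' ?ltn_add2l //.
- by rewrite ltnNge leqnSn.
- by move=> _; rewrite ltnNge leqnSn.
Qed.

(** Edges that do not cross have their other ends in weakly increasing order;
    equality would put the 1 of v and that of v' in the same column. *)
Lemma far_end_ncross e f : is_edge (val t) e -> is_edge (val t) f ->
  ~~ cross e f -> endpoint v e -> endpoint v' f ->
  (far_end v e < far_end v' f)%N.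
Proof.
move=> /existsP [c /andP [/eqP e1 /eqP e2]] /existsP [d /andP [/eqP f1 /eqP
  f2]].
have [_ trow tcol] := paramP t.
rewrite /cross /far_end; case: v v' vv' => [x|y] [x'|y'] //= /eqP xx';
  rewrite negb_or => /andP [ef fe] /eqP ex /eqP fx; move: ef fe.
- rewrite ex fx xx' ltnSn /= ltn_add2l -leqNgt leq_eqVlt =>
    /orP [/eqP/val_inj ef|//] _.
  have cd : c = d by apply: (trow (rshift _ e.2));
    rewrite ?e2 1?ef ?f2 oner_eq0.
  have : lshift q.+1 e.1 = lshift q.+1 f.1.
    by apply: (tcol _ _ c); rewrite ?upper_block_l // ?e1 1?cd ?f1 oner_eq0.
  by move=> /(congr1 val) /=; rewrite ex fx xx' => /n_Sn.
- rewrite ex fx xx' ltnSn /= andbT => _; rewrite -leqNgt leq_eqVlt =>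
    /orP [/eqP/val_inj ef|//].
  have cd : c = d by apply: (trow (lshift _ e.1));
    rewrite ?e1 1?ef ?f1 oner_eq0.
  have : rshift p.+1 e.2 = rshift p.+1 f.2.
    by apply: (tcol _ _ c); rewrite ?upper_block_r // ?e2 1?cd ?f2 oner_eq0.
  by move=> /(congr1 val) /=; rewrite ex fx xx' addnS => /n_Sn.
Qed.

Lemma caseII_label : caseII (val t) v v' ->
  (label (val t) (unsplit v') < label (val t) (unsplit v))%N.
Proof.
case/orP => [/deg_label_lt // | /existsP [e /existsP [f /and5P [ee ff ve vf
  ef]]]].
by rewrite (label_edge ee ve) (label_edge ff vf) ltnS far_end_cross.
Qed.

Lemma caseIII_label : caseIII (val t) v v' ->
  (label (val t) (unsplit v) < label (val t) (unsplit v'))%N.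
Proof.
case/orP => [/deg_label_lt // | /existsP [e /existsP [f /and5P [ee ff ve vf
  ef]]]].
by rewrite (label_edge ee ve) (label_edge ff vf) ltnS far_end_ncross.
Qed.

Lemma case_total : [|| caseI (val t) v v',
  caseII (val t) v v' | caseIII (val t) v v'].
Proof.
rewrite /caseI /caseII /caseIII.
have [lt|gt|eq_deg] := ltngtP (deg (val t) v) (deg (val t) v').
- by rewrite orbT.
- by rewrite !orbT.
have edge w : deg (val t) w = 1%N -> exists e,
  is_edge (val t) e && endpoint w e.
  by rewrite /deg; case: ifP => // _; case: ifP => // /existsP.
have deg_le2 : (deg (val t) v <= 2)%N by rewrite /deg; case: ifP => // _;
  case: ifP.
move: deg_le2 eq_deg (edge v) (edge v'); move: (deg _ v) => d d2 <-; move: d2.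
case: d => [|[|[|d]]] //= _ /(_ erefl) [e /andP [ee ve]] /(_ erefl) [f /andP
  [ff vf]].
have [ef|nef] := boolP (cross e f); apply/orP; [left|right];
  by apply/existsP; exists e; apply/existsP; exists f; rewrite ee ff ve vf.
Qed.

End Cases.

End Labels.

(** * The double coset of a simple reflection *)

(** In this section u parametrises representatives of the left cosets in B of
    the intersection of B with s B s^-1, so that B s B is the disjoint union of
    the cosets (u a) s B, and T acts as a sum over a. *)
Section DoubleCoset.

Variables (C : numFieldType) (K : finGroupType) (B : {group K}) (X : Type).
Variable act : K -> X -> X.
Hypothesis actM : forall k l x, act (k * l)%g x = act k (act l x).
Variables (s : K) (I : finType) (u : I -> K).
Hypothesis uB : forall a, u a \in B.
Hypothesis u_inj : forall a b, (s^-1 * (u a)^-1 * u b * s \in B)%g -> a = b.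
Hypothesis u_cover : forall b, b \in B -> exists a,
  (s^-1 * (u a)^-1 * b * s \in B)%g.

Lemma double_coset_indicator (k : K) :
  (k \in (B :* s * B)%g)%:R = \sum_a (((u a * s)^-1 * k)%g \in B)%:R :> C.
Proof.
have [/mulsgP [x b2 /rcosetP [b1 b1B ->] b2B ->]|kBsB] := boolP (k \in _).
  have [a ab1] := u_cover b1B.
  rewrite (bigD1 a) //= big1 ?addr0 => [|c ca].
    by rewrite invMg !mulgA groupM.
  have [cb1|//] := boolP (_ \in B); case/eqP: ca.
  have cb : (s^-1 * (u c)^-1 * b1 * s \in B)%g.
    by move: cb1; rewrite invMg !mulgA groupMr.
  apply: u_inj; have := groupM cb (groupVr ab1).
  by rewrite !invMg !invgK !mulgA mulgK mulgK.
rewrite big1 // => a _; have [ka|//] := boolP (_ \in B); case/negP: kBsB.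
apply/mulsgP; exists (u a * s)%g ((u a * s)^-1 * k)%g => //; last
  by rewrite mulKVg.
by apply/rcosetP; exists (u a).
Qed.

Lemma hecke_act_T (f : X -> C) : invariant_fun act B f ->
  forall x, hecke_act act (hecke_T C B s) f x = \sum_a f (act (u a * s)^-1%g x).
Proof.
move=> fB x; rewrite /hecke_act /hecke_T.
under eq_bigr => k _ do rewrite double_coset_indicator mulr_sumr mulr_suml.
rewrite exchange_big mulr_sumr; apply: eq_bigr => a _ /=.
rewrite -[RHS](mean_over_borel B (mulgI (u a * s)^-1%g)); congr (_ * _).
apply: eq_bigr => k _; rewrite -!mulrA; congr (_ * (_ * _)).
have [kB|_] := boolP (_ \in B); last by rewrite !mul0r.
by rewrite -(fB _ (act k^-1%g x) kB) -actM mulgK.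
Qed.

End DoubleCoset.

(** Here s exchanges the consecutive rows i0 and i1 of the same block, and u is
    the root subgroup that adds multiples of row i1 to row i0. *)
Section Swap.

Variables (F : finFieldType) (p q r : nat).
Local Notation n := (p.+1 + q.+1)%N.
Local Notation K := (grpK F p q).
Local Notation B := (borelK F p q).
Variables (i0 i1 : 'I_n) (s : K).
Hypothesis block01 : upper_block i0 = upper_block i1.
Hypothesis next01 : i1 = i0.+1 :> nat.
Hypothesis sE : blockK s = perm_mx (tperm i0 i1).
Implicit Type t : param F p q r.

Lemma i0_neq_i1 : i0 != i1.
Proof. by rewrite -val_eqE /= next01 neq_ltn leqnn. Qed.

Lemma swap_mulE m (M : 'M[F]_(n, m)) i j : (blockK s *m M) i j =
  M (tperm i0 i1 i) j.
Proof. by rewrite sE -row_permE mxE. Qed.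

Lemma mul_swapE (M : 'M[F]_n) i j : (M *m blockK s) i j = M i (tperm i0 i1 j).
Proof. by rewrite sE -tpermV -col_permE mxE tpermV. Qed.

Lemma swap_sqr : (s * s = 1)%g.
Proof.
apply: blockK_inj; rewrite blockKM blockK1; apply/matrixP => i j.
by rewrite swap_mulE sE !mxE tpermK.
Qed.

Lemma swap_inv : (s^-1 = s)%g.
Proof. by apply: (mulgI s); rewrite mulgV swap_sqr. Qed.

Lemma swap_conjE (k : K) i j :
  blockK (s * k * s)%g i j = blockK k (tperm i0 i1 i) (tperm i0 i1 j).
Proof. by rewrite !blockKM mul_swapE swap_mulE. Qed.

Lemma swap_block i : upper_block (tperm i0 i1 i) = upper_block i.
Proof. by case: tpermP => // ->. Qed.

(** Exchanging two consecutive positions reverses the order of that pair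
    only. *)
Lemma swap_order (i j : 'I_n) : (i <= j)%N -> (i, j) != (i0, i1) ->
  (tperm i0 i1 i <= tperm i0 i1 j)%N.
Proof.
move=> ij nij.
have lt (x y : 'I_n) : (x <= y)%N -> x <> y -> (x < y)%N.
  by move=> xy /eqP nxy; rewrite ltn_neqAle xy andbT.
case: tpermP => [ei | ei | ni0 ni1]; case: tpermP => [ej | ej | nj0 nj1] //.
- by rewrite ei ej eqxx in nij.
- by rewrite next01; apply: lt; rewrite -?ei // => /esym; rewrite ei.
- by rewrite next01 leqnSn.
- by move: ij; rewrite ei next01 => /ltnW.
- by rewrite next01 leqW // -ej.
- by rewrite -ltnS -next01 -ej; apply: lt ij _; rewrite ej.
Qed.

Lemma swap_conj_borel (k : K) : k \in B -> blockK k i0 i1 = 0 ->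
  (s * k * s \in B)%g.
Proof.
move=> /borelKP kB k0; apply/borelKP => i j; rewrite swap_conjE => nz.
have [] := kB _ _ nz; rewrite !swap_block => bij ij; split=> //.
have := swap_order ij; rewrite !tpermK; apply; apply: contraNneq nz => -[-> ->].
by rewrite k0.
Qed.

Lemma transvection_exists (i j : 'I_n) a : upper_block i = upper_block j ->
  (i < j)%N -> exists2 k, k \in B & 
    forall m (M : 'M[F]_(n, m)), blockK k *m M = M + (a *:
      delta_mx i 0) *m row j M.
Proof.
move=> bij ij.
have [x y|x|k kB kE] := @borel_transvection F p q (a *:
  delta_mx i 0) (delta_mx 0 j).
- rewrite !mxE /= andbT; case: (eqVneq x i) => [-> _|_]; last
    by rewrite mulr0 eqxx.
  case: (eqVneq y j) => [-> _|_]; last by rewrite eqxx.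
  by split=> //; apply: ltnW.
- rewrite !mxE /= andbT; case: (eqVneq x i) => [-> |_]; last
    by rewrite mulr0 mul0r addr0 oner_eq0.
  by rewrite -val_eqE ltn_eqF // mulr0 addr0 oner_eq0.
by exists k => // m M; rewrite kE -rowE.
Qed.

Lemma root_subgroup : exists2 u : F -> K, forall a, u a \in B &
  forall a m (M : 'M[F]_(n, m)), blockK (u a) *m M = M + (a *:
    delta_mx i0 0) *m row i1 M.
Proof.
have ex a : exists k, (k \in B) && (blockK k == 1%:M + (a *:
  delta_mx i0 0) *m row i1 1%:M).
  have [|k kB kE] := @transvection_exists i0 i1 a block01;
    first by rewrite next01.
  by exists k; rewrite kB -kE mulmx1 eqxx.
exists (fun a => xchoose (ex a)) => a; first by have /andP [] :=
  xchooseP (ex a).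
move=> m M; have /andP [_ /eqP ->] := xchooseP (ex a).
by rewrite mulmxDl mul1mx -mulmxA -row_mul mul1mx.
Qed.

Variable u : F -> K.
Hypothesis uB : forall a, u a \in B.
Hypothesis uE : forall a m (M : 'M[F]_(n, m)),
  blockK (u a) *m M = M + (a *: delta_mx i0 0) *m row i1 M.

Lemma root_mulE a m (M : 'M[F]_(n, m)) i j :
  (blockK (u a) *m M) i j = M i j + (i == i0)%:R * a * M i1 j.
Proof. by rewrite uE !mxE big_ord1 !mxE andbT [a * _]mulrC. Qed.

Lemma root_entry a i j : blockK (u a) i j =
  (i == j)%:R + (i == i0)%:R * a * (i1 == j)%:R.
Proof. by rewrite -[blockK _]mulmx1 root_mulE !mxE. Qed.

Lemma root_add a b : (u a * u b = u (a + b))%g.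
Proof.
apply: blockK_inj; apply/matrixP => i j; rewrite blockKM root_mulE !root_entry.
by rewrite [i1 == i0]eq_sym (negPf i0_neq_i1) !mul0r addr0 -addrA -mulrDl
  -mulrDr [b + a]addrC.
Qed.

Lemma root_inv a : ((u a)^-1 = u (- a))%g.
Proof.
apply: (mulgI (u a)); rewrite mulgV root_add subrr; apply: blockK_inj.
by apply/matrixP => i j; rewrite root_entry blockK1 mxE mulr0 mul0r addr0.
Qed.

Lemma root_inj a b : (s^-1 * (u a)^-1 * u b * s \in B)%g -> a = b.
Proof.
rewrite swap_inv root_inv -(mulgA s) root_add => /borelKP /(_ i1 i0).
rewrite swap_conjE tpermL tpermR root_entry (negPf i0_neq_i1) !eqxx add0r
  mul1r mulr1.
have [ab _|_ /(_ isT) []] := eqVneq (- a + b) 0; last by rewrite next01 ltnn.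
by apply/eqP; rewrite eq_sym -subr_eq0 addrC ab.
Qed.

(** The multiple of row i1 that clears the entry (i0, i1) of b; conjugation by
    s then keeps the matrix upper triangular. *)
Lemma root_cover b : b \in B -> exists a, (s^-1 * (u a)^-1 * b * s \in B)%g.
Proof.
move=> bB; exists (blockK b i0 i1 / blockK b i1 i1).
rewrite swap_inv root_inv -(mulgA s); apply: swap_conj_borel; first exact:
  borelK_M.
by rewrite blockKM root_mulE eqxx mul1r mulNr divfK ?subrr ?borelK_diag.
Qed.

(** For a != 0 this puts s (u a) in B s (u a^-1) s. In the rows and columns
    i0, i1 the element is the upper triangular matrix with rows (- a^-1, 1) and
    (0, a); the entry below the diagonal is 1 - a * a^-1. *)
Lemma swap_root_swap a : a != 0 -> (s * u a * s * u (- a^-1) * s \in B)%g.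
Proof.
move=> a0; have -> : (s * u a * s * u (- a^-1) * s =
  s * (u a * s * u (- a^-1)) * s)%g.
  by rewrite !mulgA.
apply/borelKP => i j; rewrite swap_conjE !blockKM -mulmxA root_mulE !swap_mulE
  !root_entry tpermR.
rewrite tpermK.
case: (tpermP i0 i1 j) => [-> | -> | /eqP nj0 /eqP nj1];
  case: (tpermP i0 i1 i) => [-> | -> | /eqP ni0 /eqP ni1];
  rewrite ?eqxx ?(negPf i0_neq_i1) ?[i1 == i0]eq_sym ?(negPf i0_neq_i1) //=.
all: rewrite ?mul0r ?mulr0 ?mul1r ?mulr1 ?addr0 ?add0r.
all: try by rewrite block01 next01 ?leqnn.
- by rewrite mulrN divff // subrr eqxx.
- by rewrite (negPf ni0) (negPf ni1) !mul0r !addr0 eqxx.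
- by rewrite (negPf ni0) !mul0r !addr0 eqxx.
- by rewrite !(eq_sym _ j) (negPf nj0) (negPf nj1) mulr0 addr0 eqxx.
- by rewrite !(eq_sym _ j) (negPf nj0) (negPf nj1) !(mulr0, addr0) eqxx.
rewrite (negPf ni0) !mul0r !addr0.
by case: (eqVneq i j) => [-> | _]; rewrite ?eqxx.
Qed.

End Swap.

(** * The generator of a simple reflection on each orbit *)

Lemma blockK_simple_refl (F : finFieldType) p q (v v' : vertex p.+1 q.+1) :
  consecutive v v' ->
  blockK (simple_refl F v v') = perm_mx (tperm (unsplit v) (unsplit v')).
Proof.
have lr (i : 'I_p.+1) (j : 'I_q.+1) : (lshift q.+1 i == rshift p.+1 j) = false.
  exact: eq_lrshift.
have rl (i : 'I_p.+1) (j : 'I_q.+1) : (rshift p.+1 j == lshift q.+1 i) = false.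
  exact: eq_rlshift.
case: v v' => [x|y] [x'|y'] //= _; rewrite /blockK /=; apply/matrixP => i j;
  case: (split_ordP i) => i' ->; case: (split_ordP j) => j' ->;
  rewrite ?block_mxEul ?block_mxEur ?block_mxEdl ?block_mxEdr !mxE.
- by rewrite -inj_tperm ?eq_lshift //; apply: lshift_inj.
- by rewrite -inj_tperm ?lr //; apply: lshift_inj.
- by rewrite tpermD ?lr ?rl.
- by rewrite tpermD ?lr // perm1 eq_rshift.
- by rewrite tpermD ?rl // perm1 eq_lshift.
- by rewrite tpermD ?lr ?rl.
- by rewrite -inj_tperm ?rl //; apply: rshift_inj.
- by rewrite -inj_tperm ?eq_rshift //; apply: rshift_inj.
Qed.

Section SimpleReflection.

Variables (F : finFieldType) (p q r : nat).
Local Notation n := (p.+1 + q.+1)%N.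
Local Notation K := (grpK F p q).
Local Notation B := (borelK F p q).
Variables (i0 i1 : 'I_n) (w : 'S_p.+1 * 'S_q.+1).
Local Notation s := (weylK F w).
Hypothesis block01 : upper_block i0 = upper_block i1.
Hypothesis next01 : i1 = i0.+1 :> nat.
Hypothesis sE : blockK s = perm_mx (tperm i0 i1).
Implicit Types (t : param F p q r).

Let i01 : i0 != i1 := i0_neq_i1 next01.

Lemma param_actE t : val (param_act w t) = blockK s *m val t.
Proof. by []. Qed.

Lemma param_actK t : param_act w (param_act w t) = t.
Proof.
apply: val_inj; rewrite !param_actE mulmxA -blockKM (swap_sqr sE) blockK1.
by rewrite mul1mx.
Qed.

Lemma param_class_act t t' :
  param_class t = param_class t' -> param_class (param_act w t) =
    param_class (param_act w t').
Proof.
move=> /eqP /same_orbit_classP /same_orbit_col_equiv /existsP [z /eqP tz].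
apply/eqmodP/existsP; exists z; apply/eqP.
by rewrite !param_actE tz !col_permE mulmxA.
Qed.

Lemma param_class_act_eq t t' :
  (param_class (param_act w t) == param_class t') =
    (param_class t == param_class (param_act w t')).
Proof. by apply/eqP/eqP => /param_class_act; rewrite param_actK. Qed.

Lemma label_class t t' : param_class t = param_class t' ->
  label (val t) =1 label (val t').
Proof.
by move=> /eqP /same_orbit_classP /same_orbit_sym /same_orbit_col_equiv
  /label_col_equiv.
Qed.

Lemma label_act t i : upper_block i = upper_block i0 ->
  label (val (param_act w t)) i = label (val t) (tperm i0 i1 i).
Proof.
move=> bi; have stE k c : val (param_act w t) k c = val t (tperm i0 i1 k) c.
  by rewrite param_actE (swap_mulE sE).
rewrite /label; congr (if _ then _ else _); first by apply: eq_existsb => c;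
  rewrite stE.
apply: eq_bigl => k; rewrite (swap_block block01); case: eqVneq => //= bk.
apply: eq_existsb => c; rewrite !stE [tperm _ _ k]tpermD //.
  by apply: contraNneq bk => <-; rewrite bi.
by apply: contraNneq bk => <-; rewrite bi block01.
Qed.

Lemma label_act0 t : label (val (param_act w t)) i0 = label (val t) i1.
Proof. by rewrite label_act // tpermL. Qed.

Lemma label_act1 t : label (val (param_act w t)) i1 = label (val t) i0.
Proof. by rewrite label_act // tpermR. Qed.

Variable u : F -> K.
Hypothesis uB : forall a, u a \in B.
Hypothesis uE : forall a m (M : 'M[F]_(n, m)),
  blockK (u a) *m M = M + (a *: delta_mx i0 0) *m row i1 M.

(** If row i1 vanishes there is nothing to absorb. Otherwise row i0 is nonzero
    too; let c and c' be the columns of the 1 in rows i0 and i1. Adding a times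
    row i1 to row i0 puts a in position (i0, c'); adding a times column c to
    column c' does the same, except that it also puts a at the other end k of
    the edge of row i0, if there is one. Then k < l, where l is the other end of
    the edge of row i1, so subtracting a times row l from row k is an operation
    of B; it takes place in the other block, so it commutes with s. *)
Lemma root_absorbed t a : (label (val t) i0 <= label (val t) i1)%N ->
  exists b (h : 'M[F]_r), [/\ b \in B,
    blockK s *m blockK b = blockK b *m blockK s, h \in unitmx
    & blockK (u a) *m val t = blockK b *m val t *m h].
Proof.
have [t1 trow tcol] := paramP t.
have row1 c : val t i1 c = 1 -> row i1 (val t) = delta_mx 0 c.
  move=> tc; apply/rowP => d; rewrite !mxE /=; case: (eqVneq d c) => [-> //
    | dc].
  by apply/eqP; apply: contraNT dc => td; apply/eqP/(trow i1);
    rewrite ?tc ?oner_eq0.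
have neq_col c c' : val t i0 c = 1 -> val t i1 c' = 1 -> c != c'.
  move=> tc tc'; apply: contraNneq i01 => cc'; apply/eqP/(tcol _ _ c') => //.
    by rewrite -cc' tc oner_eq0.
  by rewrite tc' oner_eq0.
pose h (c c' : 'I_r) : 'M[F]_r :=
  1%:M + delta_mx c 0 *m (a *: delta_mx 0 c' : 'rV_r).
have unit_h c c' : c != c' -> h c c' \in unitmx.
  by move=> cc'; apply: transvection_unit; rewrite !mxE (negPf cc') mulr0.
have mul_h m (M : 'M_(m, r)) c c' :
    M *m h c c' = M + a *: (col c M *m delta_mx 0 c').
  by rewrite mulmxDr mulmx1 mulmxA -colE scalemxAr.
have alone c c' : val t i0 c = 1 -> (forall k, k != i0 -> val t k c = 0) ->
    val t i1 c' = 1 ->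
    exists b (h : 'M[F]_r), [/\ b \in B,
      blockK s *m blockK b = blockK b *m blockK s, h \in unitmx
      & blockK (u a) *m val t = blockK b *m val t *m h].
  move=> tc tz tc'; exists 1%g, (h c c'); split; first exact: borelK_1.
  - by rewrite blockK1 mulmx1 mul1mx.
  - exact/unit_h/neq_col.
  rewrite uE (row1 _ tc') blockK1 mul1mx mul_h.
  have -> : col c (val t) = delta_mx i0 0.
    by apply/colP => k; rewrite !mxE andbT; case: (eqVneq k i0) => [-> | /tz].
  by rewrite -scalemxAl.
case: (labelP t i1) => [tz _|c' tc' _|c' l tc' tl bl].
- exists 1%g, 1%:M; split; [exact: borelK_1 | by rewrite blockK1 mulmx1 mul1mx
    | exact: unitmx1 |].
  rewrite uE blockK1 mul1mx mulmx1 (_ : row i1 _ = 0) ?mulmx0 ?addr0 //.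
  by apply/rowP => c; rewrite !mxE tz.
- by case: (labelP t i0) => // c tc tz _; apply: alone tc tz tc'.
case: (labelP t i0) => [_|c tc tz _|c k tc tk bk].
- by rewrite ltnS leqNgt ltn_ord.
- exact: alone tc tz tc'.
rewrite ltnS => kl; have cc' := neq_col _ _ tc tc'.
have bkl : upper_block k = upper_block l.
  by move: bk bl; rewrite block01; do 3!case: upper_block.
have lt_kl : (k < l)%N.
  rewrite ltn_neqAle kl andbT; apply: contraNneq cc' => /val_inj ekl.
  by apply/eqP/(trow k); rewrite ?tk ?ekl ?tl oner_eq0.
have [b bB bE] := transvection_exists (- a) bkl lt_kl.
have fix_s x : upper_block x != upper_block i0 -> tperm i0 i1 x = x.
  by move=> bx; apply: tpermD; apply: contraNneq bx => <-; rewrite ?block01.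
have sk := fix_s k bk.
have sl : tperm i0 i1 l = l by apply: fix_s; rewrite block01.
have b_entry i j : blockK b i j = (i == j)%:R + (i == k)%:R * - a * (l == j)%:R.
  by rewrite -[blockK b]mulmx1 bE !mxE big_ord1 !mxE andbT [- a * _]mulrC.
exists b, (h c c').
split; rewrite ?unit_h //.
  apply/matrixP => i j.
  rewrite (swap_mulE sE) (mul_swapE sE) !b_entry.
  have swap_eq x y : (tperm i0 i1 x == y) = (x == tperm i0 i1 y).
    by rewrite -{1}(tpermK i0 i1 y) (inj_eq perm_inj).
  by rewrite !swap_eq sk -[l == tperm _ _ j]swap_eq sl.
rewrite -mulmxA bE uE (row1 _ tc') row_mul.
have -> : row l (val t) = delta_mx 0 c'.
  apply/rowP => d; rewrite !mxE /=; case: (eqVneq d c') => [-> // | dc].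
  by apply/eqP; apply: contraNT dc => td; apply/eqP/(trow l);
    rewrite ?tl ?oner_eq0.
have -> : delta_mx 0 c' *m h c c' = delta_mx 0 c' :> 'rV_r.
  by rewrite mul_h colE mul_delta_mx_0 1?eq_sym // mul0mx scaler0 addr0.
rewrite mul_h.
have -> : col c (val t) = delta_mx i0 0 + delta_mx k 0.
  apply/colP => x; rewrite !mxE !andbT.
  case: (eqVneq x i0) => [-> | xi]; first rewrite tc (_ : i0 == k = false) ?addr0 //.
    by apply/negbTE; apply: contraNneq bk => <-.
  case: (eqVneq x k) => [-> | xk]; rewrite add0r //.
  apply/eqP; apply: contraT => tx.
  have [bx|bx] := eqVneq (upper_block x) (upper_block i0).
    by rewrite (tcol x i0 c) ?eqxx ?tc ?oner_eq0 // in xi.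
  rewrite (tcol x k c) ?eqxx ?tk ?oner_eq0 // in xk.
  by move: bk bx; do 3!case: upper_block.
by rewrite mulmxDl -!scalemxAl scaleNr scalerDr addrA addrK.
Qed.

Lemma root_orbit_le t a : (label (val t) i0 <= label (val t) i1)%N ->
  same_orbit (blockK (s * u a)%g *m val t) (val (param_act w t)).
Proof.
move=> /(root_absorbed a) [b [h [bB sb hU E]]]; exists b, h; split=> //.
by rewrite blockKM -mulmxA E param_actE !mulmxA sb.
Qed.

(** The reflected parameter satisfies the hypothesis of the previous lemma, and
    s (u a) t = b s (u a^-1) (s t) with b in B. *)
Lemma root_orbit_ge t a : a != 0 -> (label (val t) i1 <= label (val t) i0)%N ->
  same_orbit (blockK (s * u a)%g *m val t) (val t).
Proof.
move=> a0 lt; have := @root_orbit_le (param_act w t) a^-1.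
rewrite label_act0 label_act1 param_actK => /(_ lt); apply: same_orbit_trans.
exists (s * u a * s * u (- a^-1) * s)%g, 1%:M; rewrite unitmx1 mulmx1.
split=> //; first exact (swap_root_swap block01 next01 sE uE a0).
have ssK m (M : 'M_(n, m)) : blockK s *m (blockK s *m M) = M.
  by rewrite mulmxA -blockKM (swap_sqr sE) blockK1 mul1mx.
have uK m (M : 'M_(n, m)) : blockK (u (- a^-1)) *m (blockK (u a^-1) *m M) = M.
  by rewrite mulmxA -blockKM (root_add next01 uE) addNr uE scale0r mul0mx addr0.
by rewrite !blockKM param_actE -!mulmxA ssK uK ssK.
Qed.

(** If the labels are equal, s (u 1) t lies in the orbits of both s t and t. *)
Lemma class_act_fixed t : label (val t) i0 = label (val t) i1 ->
  param_class (param_act w t) = param_class t.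
Proof.
move=> eq_l; apply/eqP/same_orbit_classP.
apply: same_orbit_trans (@root_orbit_ge t 1 (oner_neq0 _) _); last
  by rewrite eq_l.
by apply/same_orbit_sym/root_orbit_le; rewrite eq_l.
Qed.

Lemma class_act_moved t : label (val t) i0 <> label (val t) i1 ->
  param_class (param_act w t) <> param_class t.
Proof. by move=> neq /label_class /(_ i0); rewrite label_act0 => /esym. Qed.

Variable C : numFieldType.
Local Notation T := (hecke_T C B s).

Lemma hecke_T_span_sum (c : paramQ F p q r) t :
  hecke_act Gr_act T (xi C c) (param_span t)
    = \sum_a xi C c (Gr_act (s * u a)%g (param_span t)).
Proof.
rewrite (hecke_act_T (B := borelK_group F p q) (@Gr_actM F p q r) uB
  (root_inj next01 sE uE) (root_cover block01 next01 sE uB uE) (xi_invariant C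
    c)).
rewrite (reindex_inj oppr_inj); apply: eq_bigr => a _.
by rewrite invMg (swap_inv sE) (root_inv next01 uE) opprK.
Qed.

Lemma hecke_T_span_le (c : paramQ F p q r) t :
  (label (val t) i0 <= label (val t) i1)%N ->
  hecke_act Gr_act T (xi C c) (param_span t)
    = #|F|%:R * (param_class (param_act w t) == c)%:R.
Proof.
move=> lt; rewrite hecke_T_span_sum.
rewrite (eq_bigr (fun=> (param_class (param_act w t) == c)%:R)) => [|a _].
  by rewrite sumr_const mulr_natl.
exact: xi_act (root_orbit_le a lt).
Qed.

Lemma hecke_T_span_ge (c : paramQ F p q r) t :
  (label (val t) i1 <= label (val t) i0)%N ->
  hecke_act Gr_act T (xi C c) (param_span t)
    = (param_class (param_act w t) == c)%:R + (#|F|%:R - 1) * (param_class t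
      == c)%:R.
Proof.
move=> lt; rewrite hecke_T_span_sum (bigD1 0) //=; congr (_ + _).
  apply: xi_act; rewrite blockKM -mulmxA uE scale0r mul0mx addr0.
  exact: same_orbit_refl.
rewrite (eq_bigr (fun=> (param_class t == c)%:R)) => [|a a0].
  rewrite sumr_const cardC1 -[_ *+ #|F|.-1]mulr_natl; congr (_ * _).
  by rewrite -subn1 natrB // -cardsT; apply/card_gt0P; exists 0.
exact: xi_act (root_orbit_ge a0 lt).
Qed.

Lemma hecke_T_xi_invariant (c : paramQ F p q r) :
  invariant_fun Gr_act B (hecke_act Gr_act T (xi C c)).
Proof.
exact (hecke_act_invariant (B := borelK_group F p q) (@Gr_actM F p q r) _
  (@in_hecke_T C _ (borelK_group F p q) s)).
Qed.

(** In the next three lemmas the points [t'] are split according to which of the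
    two labels of t' is larger. As s exchanges the labels, each part meets at
    most one of the orbits of t and s t, so at most one term of each formula
    survives there. *)
Lemma hecke_T_label_eq t : label (val t) i0 = label (val t) i1 -> forall V,
  hecke_act Gr_act T (xi C (param_class t)) V =
    #|F|%:R * xi C (param_class t) V.
Proof.
move=> eq_t; apply: invariant_ext => [|k V kB|t']; first exact:
  hecke_T_xi_invariant.
  by rewrite xi_invariant.
rewrite xi_span; have [le|lt] := leqP (label (val t') i0) (label (val t') i1).
  by rewrite (hecke_T_span_le _ le) param_class_act_eq (class_act_fixed eq_t).
have ne : (param_class t' == param_class t) = false.
  by apply: contraTF lt => /eqP /label_class e; rewrite !e eq_t ltnn.
rewrite (hecke_T_span_ge _ (ltnW lt)) param_class_act_eq (class_act_fixed
  eq_t) ne.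
by rewrite !mulr0 addr0.
Qed.

Lemma hecke_T_label_gt t : (label (val t) i1 < label (val t) i0)%N -> forall V,
  hecke_act Gr_act T (xi C (param_class t)) V
    = (#|F|%:R - 1) * xi C (param_class t) V
      + #|F|%:R * xi C (param_class (param_act w t)) V.
Proof.
move=> lt_t; apply: invariant_ext => [|k V kB|t']; first exact:
  hecke_T_xi_invariant.
  by rewrite !xi_invariant.
rewrite !xi_span; have [le|lt] := leqP (label (val t') i0) (label (val t') i1).
  have ne : (param_class t' == param_class t) = false.
    by apply: contraTF le => /eqP /label_class e; rewrite !e -ltnNge.
  by rewrite (hecke_T_span_le _ le) param_class_act_eq ne mulr0 add0r.
have ne : (param_class t' == param_class (param_act w t)) = false.
  apply: contraTF lt => /eqP /label_class e.
  by rewrite !e label_act0 label_act1 -leqNgt ltnW.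
by rewrite (hecke_T_span_ge _ (ltnW lt)) param_class_act_eq ne mulr0 add0r
  addr0.
Qed.

Lemma hecke_T_label_lt t : (label (val t) i0 < label (val t) i1)%N -> forall V,
  hecke_act Gr_act T (xi C (param_class t)) V =
    xi C (param_class (param_act w t)) V.
Proof.
move=> lt_t; apply: invariant_ext => [||t']; [exact:
  hecke_T_xi_invariant | exact: xi_invariant |].
rewrite !xi_span; have [le|lt] := leqP (label (val t') i0) (label (val t') i1).
  have ne : (param_class t' == param_class (param_act w t)) = false.
    apply: contraTF le => /eqP /label_class e.
    by rewrite !e label_act0 label_act1 -ltnNge.
  by rewrite (hecke_T_span_le _ le) param_class_act_eq ne mulr0.
have ne : (param_class t' == param_class t) = false.
  by apply: contraTF lt => /eqP /label_class e; rewrite !e -leqNgt ltnW.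
by rewrite (hecke_T_span_ge _ (ltnW lt)) param_class_act_eq ne mulr0 addr0.
Qed.

End SimpleReflection.

(** * The theorem *)

Theorem theorem7p5 (R : realType) (F : finFieldType) (p q r : nat)
    (char_F : 2%N \notin [pchar F])
    (r_gt0 : (0 < r)%N) (r_lt_n : (r < p.+1 + q.+1)%N) :
  [/\ hecke_is_algebra R[i] (borelK F p q)
        /\ hecke_acts R[i] (borelK F p q) (Gr_act (r := r)),
      (forall Phi : doubleflag F p q r -> R[i],
         invariant_fun doubleflag_act [set: grpK F p q] Phi ->
         invariant_fun Gr_act (borelK F p q) (base_restr Phi))
      /\ (forall f : Gr F p q r -> R[i],
         invariant_fun Gr_act (borelK F p q) f ->
         exists Phi : doubleflag F p q r -> R[i],
           [/\ invariant_fun doubleflag_act [set: grpK F p q] Phi,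
               base_restr Phi =1 f
             & forall Psi : doubleflag F p q r -> R[i],
                 invariant_fun doubleflag_act [set: grpK F p q] Psi ->
                 base_restr Psi =1 f -> Psi =1 Phi]),
      (forall c : paramQ F p q r,
         invariant_fun Gr_act (borelK F p q) (xi R[i] c))
      /\ (forall f : Gr F p q r -> R[i],
         invariant_fun Gr_act (borelK F p q) f ->
         exists! a : {ffun paramQ F p q r -> R[i]},
           forall V : Gr F p q r, f V = \sum_c a c * xi R[i] c V)
    & forall (t : param F p q r) (v v' : vertex p.+1 q.+1),
        consecutive v v' ->
        let tau := param_class t in
        let s_tau := param_class (param_act (vertex_swap v v') t) in
        let T := hecke_T R[i] (borelK F p q) (simple_refl F v v') in
        [/\ [|| caseI (val t) v v', caseII (val t) v v'
              | caseIII (val t) v v'],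
            caseI (val t) v v' ->
              s_tau = tau
              /\ forall V : Gr F p q r,
                   hecke_act Gr_act T (xi R[i] tau) V
                   = #|F|%:R * xi R[i] tau V,
            caseII (val t) v v' ->
              s_tau <> tau
              /\ forall V : Gr F p q r,
                   hecke_act Gr_act T (xi R[i] tau) V
                   = (#|F|%:R - 1) * xi R[i] tau V
                     + #|F|%:R * xi R[i] s_tau V
          & caseIII (val t) v v' ->
              s_tau <> tau
              /\ forall V : Gr F p q r,
                   hecke_act Gr_act T (xi R[i] tau) V = xi R[i] s_tau V]].
Proof.
split.
- split; first exact: (hecke_algebraP _ (borelK_group F p q)).
  exact: (hecke_actsP _ (borelK_group F p q) (@Gr_actM F p q r)).
- by split=> [Phi | f]; [exact: base_restr_invariant | exact: base_restr_extension].
- by split=> [c | f]; [exact: xi_invariant | exact: xi_basis].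
move=> t v v' vv' tau s_tau T.
have [block01 next01] := consecutive_rows vv'.
have sE : blockK (weylK F (vertex_swap v v')) = perm_mx (tperm (unsplit v) (unsplit v')).
  exact: blockK_simple_refl vv'.
have [u uB uE] := root_subgroup F block01 next01.
split.
- exact: case_total.
- move=> /caseI_label eq_t; split; first exact: (class_act_fixed block01 next01 sE uE eq_t).
  exact (hecke_T_label_eq block01 next01 sE uB uE R[i] eq_t).
- move=> is_II; have lt_t := caseII_label vv' is_II; split.
    have neq : label (val t) (unsplit v) <> label (val t) (unsplit v').
      by apply/eqP; rewrite neq_ltn lt_t ?orbT.
    exact (class_act_moved block01 sE neq).
  exact (hecke_T_label_gt block01 next01 sE uB uE R[i] lt_t).
- move=> is_III; have lt_t := caseIII_label vv' is_III; split.
    have neq : label (val t) (unsplit v) <> label (val t) (unsplit v').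
      by apply/eqP; rewrite neq_ltn lt_t ?orbT.
    exact (class_act_moved block01 sE neq).
  exact (hecke_T_label_lt block01 next01 sE uB uE R[i] lt_t).
Qed.
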